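(* Let $A$ be either $\mathbb{H}$ or $\mathbb{O}$. Let $\Omega_0\subset A$ be a discrete set of singularities and let $f$ be a slice-Nash function on $A\setminus\Omega_0$. Then there exist two slice polynomials $P,Q\in A[x]$ such that $f(x)=(Q^{-\bullet}\cdot P)(x)$ for each $x\in A\setminus\Omega_0$.
   Context: $\mathbb{H}$ (quaternions) and $\mathbb{O}$ (octonions) carry the standard conjugation $x\mapsto x^c$; $\mathbb{S}_A=\{I\in A: I^2=-1\}$. Put $u_A=1$ if $A=\mathbb{H}$ and $u_A=3$ if $A=\mathbb{O}$. The complex field is $\mathbb{C}=\{\alpha+\iota\beta\}$ with $\iota\notin\mathbb{S}_A$. For $I\in\mathbb{S}_A$, $\mathbb{C}_I=\mathbb{R}+\mathbb{R}I$. For $D\subset\mathbb{C}$, $\Omega_D=\{\alpha+\beta I:\alpha+\iota\beta\in D,\ I\in\mathbb{S}_A\}$; $\Omega\subset A$ is circular if $\Omega=\Omega_D$ for some $D$, where $D$ is always taken invariant under complex conjugation (then it is determined by $\Omega$). For $y=\alpha+\beta I\in A$ let $\mathbb{S}_y=\{\alpha+\beta J:J\in\mathbb{S}_A\}$. A discrete set of singularities in an open circular set $\Omega$ is a subset $\Omega_0\subset\Omega$, closed in $\Omega$, which is a union of isolated points of the real axis and isolated spheres $\mathbb{S}_y$, $y\in\Omega\setminus\mathbb{R}$. Elements of $A\otimes_{\mathbb{R}}\mathbb{C}$ are $x+\iota y$ ($x,y\in A$), with product $(x+\iota y)(x'+\iota y')=xx'-yy'+\iota(xy'+yx')$, $\overline{x+\iota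 y}=x-\iota y$ and $(x+\iota y)^c=x^c+\iota y^c$. A stem function on an open conjugation-invariant $D\subset\mathbb{C}$ is $F=F_1+\iota F_2:D\to A\otimes_{\mathbb{R}}\mathbb{C}$ with $F(\overline z)=\overline{F(z)}$. It induces the slice function $f=\mathcal{I}(F):\Omega_D\to A$, $f(\alpha+\beta I)=F_1(\alpha+\iota\beta)+I\,F_2(\alpha+\iota\beta)$; every slice function comes from a unique stem function. $f$ is slice regular if $F$ is holomorphic, i.e. $C^1$ with $\frac{\partial F}{\partial\alpha}+\iota\frac{\partial F}{\partial\beta}=0$. For $f=\mathcal{I}(F)$, $g=\mathcal{I}(G)$ the slice product is $f\cdot g=\mathcal{I}(FG)$; $f^c=\mathcal{I}(F^c)$ with $F^c(z)=F(z)^c$; $N(f)=f\cdot f^c$; $V(g)$ is the zero set of $g$. When $\Omega\setminus V(N(f))\ne\varnothing$, $f^{-\bullet}$ is the slice function on $\Omega\setminus V(N(f))$ given by $f^{-\bullet}(x)=(N(f)(x))^{-1}f^c(x)$; it is the inverse of $f$ for the slice product there. $A[x]$ is the set of slice polynomials $\sum_{s=0}^n x^s\alpha_s$ with $\alpha_s\in A$, identified with the slice regular functions on $A$ they define. A function $g:D\to\mathbb{C}$ on an open $D\subset\mathbb{C}$ is complex Nash if every point of $D$ has an open neighbourhood $U\subset D$ on which $g$ is holomorphic and satisfies $P(z,g(z))=0$ for some non-zero $P\in\mathbb{C}[z,t]$. For $I\in\mathbb{S}_A$, $A$ is a $\mathbb{C}_I$-vector space by left multiplication; if $\{1,I_1,\ldots,I_{u_A}\}$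 is a base over $\mathbb{C}_I$, then $\{I_0:=1,I,I_1,II_1,\ldots,I_{u_A},II_{u_A}\}$ is called a splitting base of $A$ associated to $I$. Write uniquely $F_s=\sum_{k=0}^{u_A}(F_{s,1}^{I,I_k}+F_{s,2}^{I,I_k}I)I_k$ ($s=1,2$) with real-valued coefficients, and $F^{\ell}_{I,I_k}=F_{1,\ell}^{I,I_k}+\iota F_{2,\ell}^{I,I_k}:D\to\mathbb{C}$ ($\ell=1,2$). $F$ is stem-Nash on $D$ if for some $I$ and some splitting base associated to $I$ all $F^{\ell}_{I,I_k}$ are complex Nash on $D$. $f=\mathcal{I}(F)$ is slice-Nash on $\Omega_D$ if it is slice regular and $F$ is stem-Nash on $D$. *)

(* Defs.v *)
From HB Require Import structures.
From mathcomp Require Import all_boot all_order all_algebra.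
From mathcomp Require Import complex.
From mathcomp Require Import all_classical all_reals all_analysis.

Set Implicit Arguments.
Unset Strict Implicit.
Unset Printing Implicit Defensive.

Import Order.TTheory GRing.Theory Num.Theory.
Import numFieldNormedType.Exports.

Local Open Scope classical_set_scope.
Local Open Scope ring_scope.
Local Open Scope complex_scope.

(* A record rather than a ring structure: octonions are not associative, and
   the pointwise product that MathComp puts on pairs must not be used. *)
Record starAlg (R : realType) := StarAlg {
  scarrier :> normedModType R;
  sone : scarrier;
  smul : scarrier -> scarrier -> scarrier;
  sconj : scarrier -> scarrier }.

Arguments sone {R A} : rename.
Arguments smul {R A} : rename.
Arguments sconj {R A} : rename.

Definition real_alg (R : realType) : starAlg R :=
  @StarAlg R (R^o : normedModType R) (1 : R) (fun x y : R => x * y) id.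

(* Cayley-Dickson: (a, b) (c, d) = (a c - d^c b, d a + b c^c). *)
Definition cayley_dickson (R : realType) (A : starAlg R) : starAlg R :=
  @StarAlg R ((A * A)%type : normedModType R)
    (sone, 0)
    (fun x y => (smul x.1 y.1 - smul (sconj y.2) x.2,
                 smul y.2 x.1 + smul x.2 (sconj y.1)))
    (fun x => (sconj x.1, - x.2)).

Definition quaternions (R : realType) : starAlg R :=
  cayley_dickson (cayley_dickson (real_alg R)).

Definition octonions (R : realType) : starAlg R :=
  cayley_dickson (quaternions R).

Inductive HO := HH | OO.

Definition HOalg (R : realType) (k : HO) : starAlg R :=
  match k with HH => quaternions R | OO => octonions R end.

Definition HOu (k : HO) : nat := match k with HH => 1 | OO => 3 end.

Section SliceFunctions.
Variables (R : realType) (A : starAlg R).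

Local Notation C := (R[i]^o).
Local Notation Re := complex.Re.
Local Notation Im := complex.Im.
Local Notation "x *q y" := (smul x y) (at level 40, left associativity).

Definition SA : set A := [set I : A | I *q I = - sone].

Definition spt (z : C) (I : A) : A := Re z *: sone + Im z *: I.

Definition circularization (D : set C) : set A :=
  [set x | exists z I, [/\ D z, SA I & x = spt z I]].

Definition conj_invariant (D : set C) := forall z, D z -> D (conjc z).

(* For circular Omega, this is the conjugation-invariant D with
   Omega = circularization D. *)
Definition profile (Omega : set A) : set C :=
  [set z | exists2 I, SA I & Omega (spt z I)].

(* sphere y = [set y] when y is real. *)
Definition sphere (y : A) : set A :=
  [set x | exists z I J, [/\ SA I, SA J, y = spt z I & x = spt z J]].

(* Real points and non-real spheres are treated at once: Omega0 is a union of
   sets [sphere y], each of them isolated in Omega0. *)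
Definition discrete_singularities (Omega Omega0 : set A) :=
  [/\ Omega0 `<=` Omega,
      exists2 K : set A, closed K & Omega0 = Omega `&` K &
      forall y, Omega0 y -> exists2 U : set A,
        open U & Omega0 `&` U = sphere y].

(* The pair (x, y) is the element x + iota y of the complexified algebra. *)
Local Notation AC := (A * A)%type.

Definition acmul (p q : AC) : AC :=
  (p.1 *q q.1 - p.2 *q q.2, p.1 *q q.2 + p.2 *q q.1).
Definition acbar (p : AC) : AC := (p.1, - p.2).
Definition acconj (p : AC) : AC := (sconj p.1, sconj p.2).
Definition aciota (p : AC) : AC := (- p.2, p.1).

Definition stem (D : set C) (F : C -> AC) :=
  conj_invariant D /\ forall z, D z -> F (conjc z) = acbar (F z).

Definition induces (D : set C) (F : C -> AC) (f : A -> A) :=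
  forall z I, D z -> SA I -> f (spt z I) = (F z).1 + I *q (F z).2.

Definition partial_re (F : C -> AC) (z : C) : AC :=
  derive1 (fun t : R => F (t +i* Im z)) (Re z).
Definition partial_im (F : C -> AC) (z : C) : AC :=
  derive1 (fun t : R => F (Re z +i* t)) (Im z).

Definition holomorphic_stem (D : set C) (F : C -> AC) :=
  forall z, D z ->
  [/\ derivable (fun t : R => F (t +i* Im z)) (Re z) 1,
      derivable (fun t : R => F (Re z +i* t)) (Im z) 1,
      {for z, continuous (partial_re F)},
      {for z, continuous (partial_im F)} &
      partial_re F z + aciota (partial_im F z) = 0].

(* P in C[z, t] has t as its outer variable and z as its inner one. *)
Definition complex_nash (D : set C) (g : C -> C) :=
  forall w, D w -> exists U : set C,
  [/\ open U, U w, U `<=` D,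
      forall z, U z -> derivable g z 1 &
      exists2 P : {poly {poly R[i]}}, P != 0 &
        forall z, U z -> P.[(g z)%:P].[z] = 0].

(* (a + b I) x, the C_I-vector space structure on A; c = a + iota b encodes
   the scalar a + b I. *)
Definition cscale (I : A) (c : C) (x : A) : A := spt c I *q x.

Definition CI_basis (I : A) (n : nat) (e : 'I_n -> A) :=
  (forall c : 'I_n -> C, \sum_(k < n) cscale I (c k) (e k) = 0 ->
     forall k, c k = 0)
  /\ (forall x : A, exists c : 'I_n -> C,
     x = \sum_(k < n) cscale I (c k) (e k)).

(* [u] is u_A; e = (1, I_1, ..., I_u) determines the splitting base
   (1, I, I_1, I I_1, ..., I_u, I I_u). The functions G1 k and G2 k are
   F^1_{I,I_k} and F^2_{I,I_k}. *)
Definition stem_nash (u : nat) (D : set C) (F : C -> AC) :=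
  exists I (e : 'I_u.+1 -> A) (G1 G2 : 'I_u.+1 -> C -> C),
  [/\ SA I, e ord0 = sone, CI_basis I e,
      forall z, D z ->
        (F z).1 = \sum_(k < u.+1) cscale I (Re (G1 k z) +i* Re (G2 k z)) (e k)
        /\
        (F z).2 = \sum_(k < u.+1) cscale I (Im (G1 k z) +i* Im (G2 k z)) (e k) &
      forall k, complex_nash D (G1 k) /\ complex_nash D (G2 k)].

Definition slice_nash (u : nat) (Omega : set A) (f : A -> A) :=
  exists (D : set C) (F : C -> AC),
  [/\ open D, Omega = circularization D, stem D F & induces D F f] /\
  (holomorphic_stem D F /\ stem_nash u D F).

(* Slice functions on Omega are total functions, of which only the values on
   Omega matter; likewise for stem functions. *)
Definition stem_of (Omega : set A) (f : A -> A) : C -> AC :=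
  xget (fun=> 0)
    [set F | stem (profile Omega) F /\ induces (profile Omega) F f].

Definition slice_of (F : C -> AC) (x : A) : A :=
  xget 0 [set v | exists z I,
    [/\ SA I, x = spt z I & v = (F z).1 + I *q (F z).2]].

Definition slice_mul (Omega : set A) (f g : A -> A) : A -> A :=
  slice_of (fun z => acmul (stem_of Omega f z) (stem_of Omega g z)).

Definition slice_conj (Omega : set A) (f : A -> A) : A -> A :=
  slice_of (fun z => acconj (stem_of Omega f z)).

Definition slice_norm (Omega : set A) (f : A -> A) : A -> A :=
  slice_mul Omega f (slice_conj Omega f).

Definition sinv (x : A) : A :=
  xget 0 [set y | x *q y = sone /\ y *q x = sone].

Definition slice_inv_dom (Omega : set A) (f : A -> A) : set A :=
  [set x | Omega x /\ slice_norm Omega f x != 0].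

(* Meaningful on slice_inv_dom Omega f only. *)
Definition slice_inv (Omega : set A) (f : A -> A) : A -> A :=
  fun x => sinv (slice_norm Omega f x) *q slice_conj Omega f x.

Definition spow (x : A) (n : nat) : A := iter n (smul x) sone.

Definition slice_poly (a : seq A) (x : A) : A :=
  \sum_(s < size a) spow x s *q a`_s.

End SliceFunctions.

(* Main.v *)
Require Import Defs.
From mathcomp Require Import all_boot all_order all_algebra.
From mathcomp Require Import complex ring lra.
From mathcomp Require Import all_classical all_reals all_analysis.

Set Implicit Arguments.
Unset Strict Implicit.
Unset Printing Implicit Defensive.

Import Order.TTheory GRing.Theory Num.Theory.
Import numFieldNormedType.Exports.
Import Normc.

Local Open Scope classical_set_scope.
Local Open Scope ring_scope.
Local Open Scope complex_scope.

(* Each component of the stem function in a splitting base is a complex Nash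
   function G on the plane minus a closed discrete set, and such a G is
   rational. Let P(z,t) be a relation of minimal degree in t that holds along
   G on some open set. It is irreducible in t, so Bezout and connectedness
   propagate it to the whole domain, and G has a Taylor expansion away from
   the zeros of P_t(z, G(z)), which form a locally finite set. If a is the
   leading coefficient of P, then a G has polynomial growth, so it is a
   polynomial by the removable singularity and Liouville theorems; these need
   only a maximum principle, which second order Taylor expansions at single
   points suffice to prove. In lowest terms G = p / q, where q cannot vanish on
   the domain because q G = p is continuous. If r is a common denominator of
   all components times its conjugate, then r has real coefficients, r F is
   polynomial in z, and its coefficients lie in A by the stem symmetry. *)

(** * Pointwise Taylor expansions *)

(** Analysis enters only through expansions at one point: a continuous root of a polynomial relation
    with nonzero t-derivative has expansions of every order there. Hence every analytic statement
    carries a locally finite set [E] on which only a growth bound is known, and density with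
    continuity removes [E] at the end. Relations live in K[z][t] rather than K(z)[t], so that they
    can be evaluated at points; divisibility and Bezout identities then hold up to a nonzero factor
    in K[z], whose roots join the exceptional set. The denominator is made real to get around the
    missing associativity of the octonions. A real polynomial r acts on the complexified algebra by
    central scalars, so the slice polynomial Q with stem function r satisfies Q^c = Q and N(Q) =
    r^2, its slice inverse is 1/r, and the slice product with that inverse is a scalar division of
    stem functions. *)

Section ComplexPlane.
Variable R : realType.
Local Notation C := (R[i]^o).
Local Notation Re := complex.Re.
Local Notation Im := complex.Im.
Implicit Types (z w a b : C) (h k g : C -> C) (E D P Q : set C).

Lemma norm_normc z : `|z| = (normc z)%:C.
Proof. by []. Qed.

Lemma normc_ge0 z : 0 <= normc z.
Proof. by have := normr_ge0 z; rewrite norm_normc ler0c. Qed.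

Lemma normc_neq0 z : (normc z == 0) = (z == 0).
Proof.
by apply/eqP/eqP => [/eq0_normc //|->]; exact: normc0.
Qed.

Lemma normc_gt0 z : (0 < normc z) = (z != 0).
Proof. by rewrite lt_def normc_ge0 andbT normc_neq0. Qed.

Lemma normcX z n : normc (z ^+ n) = normc z ^+ n.
Proof.
elim: n => [|n IH]; first by rewrite !expr0 normc1.
by rewrite !exprS normcM IH.
Qed.

Lemma normcB z w : normc (z - w) = normc (w - z).
Proof. by rewrite -normcN opprB. Qed.

(* [R]-valued radii make minima and comparisons of radii total. *)
Definition evt a P := exists2 d : R, 0 < d & forall z, normc (z - a) < d -> P z.

Lemma evtI a P Q : evt a P -> evt a Q -> evt a (P `&` Q).
Proof.
move=> [d d0 dP] [e e0 eQ]; exists (Num.min d e); first by rewrite lt_min d0.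
by move=> z; rewrite lt_min => /andP[/dP ? /eQ ?].
Qed.

Lemma evtS a P Q : P `<=` Q -> evt a P -> evt a Q.
Proof. by move=> PQ [d d0 dP]; exists d => // z /dP /PQ. Qed.

Lemma evt_point a P : evt a P -> P a.
Proof. by move=> [d d0]; apply; rewrite subrr normc0. Qed.

Lemma evtW a P : (forall z, P z) -> evt a P.
Proof. by move=> H; exists 1. Qed.

Lemma evtE a P : evt a P <-> nbhs a P.
Proof.
split.
  move=> [d d0 H]; apply/nbhs_ballP; exists d%:C => /=; first by rewrite ltcR.
  by move=> z; rewrite /ball /= distrC norm_normc ltcR => /H.
(* A positive element of [R[i]] has zero imaginary part, so the radius is real. *)
move=> /nbhs_ballP[[d d']]; rewrite /= ltcE /= => /andP[/eqP -> d0] H.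
exists d => // z zd; apply: H; rewrite /ball /= distrC norm_normc.
by rewrite -[ltRHS]/(d%:C) ltcR.
Qed.

Lemma open_evt D : open D <-> forall z, D z -> evt z D.
Proof. by rewrite openE; split => H z /H /evtE. Qed.

Lemma continuous_evt h a : {for a, continuous h} <->
  forall e : R, 0 < e -> evt a [set z | normc (h z - h a) < e].
Proof.
split.
  move=> H e e0; have := (@cvgrPdist_lt _ _ _ _ _ h (h a)).1 H e%:C.
  rewrite ltcR => /(_ _ e0) => /evtE; apply: evtS => z /=.
  by rewrite distrC norm_normc ltcR.
move=> H; apply: (@cvgrPdist_lt _ _ _ _ (nbhs_filter a) h (h a)).2 => -[e e'].
rewrite ltcE /= => /andP[/eqP -> e0]; apply/evtE.
move: (H e e0); apply: evtS => z /= he; rewrite distrC norm_normc.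
by rewrite -[ltRHS]/(e%:C) ltcR.
Qed.

Lemma continuous_near h k a : evt a [set z | h z = k z] ->
  {for a, continuous h} -> {for a, continuous k}.
Proof.
move=> hk /continuous_evt hc; apply/continuous_evt => e /hc.
move=> /(evtI hk); apply: evtS => z /= [<-].
by rewrite (evt_point hk).
Qed.

Lemma evt_neq0 h a : {for a, continuous h} -> h a != 0 ->
  evt a [set z | h z != 0].
Proof.
move=> /continuous_evt hc ha.
have := hc (normc (h a)); rewrite normc_gt0 => /(_ ha).
by apply: evtS => z /=; apply: contraTneq => ->; rewrite sub0r normcN ltxx.
Qed.

(** Unfolded, h = c_0 + ... + c_(n-1) (z - a)^(n-1) + (z - a)^n h_n with [h_n] continuous at [a]: a
    Taylor expansion at the single point [a], which says nothing about derivatives at nearby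
    points. *)
Fixpoint smooth (n : nat) h a : Prop :=
  if n is m.+1 then exists2 h1 : C -> C,
    evt a [set z | h z = h a + (z - a) * h1 z] & smooth m h1 a
  else {for a, continuous h}.

Lemma smooth_continuous n h a : smooth n h a -> {for a, continuous h}.
Proof.
elim: n h => [//|n IH] h /= [h1 hE /IH h1c].
have hE' : evt a [set z | h a + (z - a) * h1 z = h z].
  by move: hE; apply: evtS => z /= ->.
apply: (continuous_near hE').
have c1 : {for a, continuous (fun z => z - a)}.
  by apply: continuousD; [exact: cvg_id|exact: cst_continuous].
by apply: continuousD; [exact: cst_continuous|exact: (continuousM c1 h1c)].
Qed.

Lemma smoothW n h a : smooth n.+1 h a -> smooth n h a.
Proof.
elim: n h => [|n IH] h; first exact: (@smooth_continuous 1).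
by move=> [h1 hE /IH h1s]; exists h1.
Qed.

Lemma smooth_cst n (c : C) a : smooth n (fun=> c) a.
Proof.
elim: n c => [|n IH] c; first exact: cst_continuous.
by exists (fun=> 0) => //; apply: evtW => z /=; rewrite mulr0 addr0.
Qed.

Lemma smooth_id n a : smooth n id a.
Proof.
case: n => [|n]; first exact: cvg_id.
exists (fun=> 1); last exact: smooth_cst.
by apply: evtW => z /=; rewrite mulr1 subrKC.
Qed.

Lemma smoothD n h k a : smooth n h a -> smooth n k a ->
  smooth n (fun z => h z + k z) a.
Proof.
elim: n h k => [|n IH] h k; first by move=> hc kc; exact: (continuousD hc kc).
move=> [h1 hE hs] [k1 kE ks]; exists (fun z => h1 z + k1 z); last exact: IH.
move: (evtI hE kE); apply: evtS => z /= [-> ->]; ring.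
Qed.

Lemma smoothM n h k a : smooth n h a -> smooth n k a ->
  smooth n (fun z => h z * k z) a.
Proof.
elim: n h k => [|n IH] h k; first by move=> hc kc; exact: (continuousM hc kc).
(* The difference quotient of the product keeps one whole factor [k], which is therefore needed at
   the lower order as well. *)
move=> hS kS; have kS' := smoothW kS; case: hS kS => h1 hE hs [k1 kE ks].
exists (fun z => h1 z * k z + h a * k1 z).
  move: (evtI hE kE); apply: evtS => z /= [-> ->]; ring.
apply: smoothD; apply: IH => //; exact: smooth_cst.
Qed.

Lemma smooth_near n h k a : evt a [set z | h z = k z] ->
  smooth n h a -> smooth n k a.
Proof.
move=> hk; case: n => [|n] /=; first exact: continuous_near.
move=> [h1 hE hs]; exists h1 => //.
by move: (evtI hk hE); apply: evtS => z /= [<-]; rewrite (evt_point hk).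
Qed.

Lemma smoothV n h a : h a != 0 -> smooth n h a -> smooth n (fun z => (h z)^-1) a.
Proof.
move=> ha; elim: n h ha => [|n IH] h ha; first by move=> hc; exact: (continuousV ha hc).
move=> hS; have hS' := smoothW hS; have hc := smooth_continuous hS.
case: hS => h1 hE hs.
exists (fun z => - (h a)^-1 * (h1 z * (h z)^-1)); last first.
  apply: smoothM; first exact: smooth_cst.
  by apply: smoothM => //; exact: IH.
move: (evtI (evt_neq0 hc ha) hE); apply: evtS => z /= [hz0 hz].
have E1 : (z - a) * h1 z = h z - h a by rewrite hz addrAC subrr add0r.
rewrite [RHS](_ : _ = (h a)^-1 - (h a)^-1 * (h z)^-1 * ((z - a) * h1 z)); last by ring.
by rewrite E1 mulrBr divfK // mulrAC mulVf // mul1r opprB subrKC.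
Qed.

Lemma smooth_exp n h a m : smooth n h a -> smooth n (fun z => h z ^+ m) a.
Proof.
move=> hs; elim: m => [|m IH]; first exact: smooth_cst.
rewrite (_ : (fun z => _) = (fun z => h z * h z ^+ m)); first exact: smoothM.
by apply/funext => z; rewrite exprS.
Qed.

Lemma smooth_poly n (p : {poly R[i]}) a : smooth n (fun z => p.[z]) a.
Proof.
elim/poly_ind: p => [|p c IH].
  by rewrite (_ : (fun _ => _) = (fun=> 0)); [exact: smooth_cst|
    apply/funext => z; rewrite horner0].
rewrite (_ : (fun _ => _) = (fun z : C => p.[z] * z + c)); last first.
  by apply/funext => z; rewrite hornerMXaddC.
apply: smoothD; last exact: smooth_cst.
by apply: smoothM => //; exact: smooth_id.
Qed.

Lemma smooth_poly2 n (P : {poly {poly R[i]}}) h a : smooth n h a ->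
  smooth n (fun z => P.[(h z)%:P].[z]) a.
Proof.
move=> hs; elim/poly_ind: P => [|P c IH].
  by rewrite (_ : (fun _ => _) = (fun=> 0)); [exact: smooth_cst|
    apply/funext => z; rewrite !horner0].
rewrite (_ : (fun _ => _) = (fun z : C => P.[(h z)%:P].[z] * h z + c.[z])); last first.
  by apply/funext => z; rewrite hornerMXaddC hornerD hornerM hornerC.
apply: smoothD; last exact: smooth_poly.
exact: smoothM.
Qed.

(* A simple root of an algebraic equation is smooth to every order: the
   equation gives g(z) = g(a) + (z - a) u(z) where u is a rational expression
   in z and g, so that each order of smoothness of g yields the next one. *)
Lemma algebraic_smooth n (P : {poly {poly R[i]}}) g a :
  {for a, continuous g} ->
  evt a [set z | P.[(g z)%:P].[z] = 0] ->
  P^`().[(g a)%:P].[a] != 0 ->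
  smooth n g a.
Proof.
move=> gc gP P'0.
(* Write P = p0 + (t - g(a)) Q and p0 = (z - a) q0. Along g the relation reads (g(z) - g(a)) Q(z,
   g(z)) = - (z - a) q0(z), and Q(a, g(a)) is the nonzero t-derivative of P. *)
pose p0 := P.[(g a)%:P].
have /factor_theorem[Q PQ] : root (P - p0%:P) (g a)%:P.
  by rewrite /root hornerD hornerN hornerC subrr.
have /factor_theorem[q0 p0q] : root p0 a.
  by rewrite /root; apply/eqP; exact: evt_point gP.
have Q0 : Q.[(g a)%:P].[a] != 0.
  move: P'0; rewrite (_ : P = p0%:P + Q * ('X - (g a)%:P%:P)); last by rewrite -PQ subrKC.
  rewrite derivD derivC add0r derivM derivXsubC mulr1 hornerD hornerM.
  by rewrite hornerXsubC subrr mulr0 add0r.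
elim: n => [//|n IH].
have Qs := smooth_poly2 Q IH.
exists (fun z => - q0.[z] * (Q.[(g z)%:P].[z])^-1); last first.
  apply: smoothM; last exact: smoothV.
  rewrite (_ : (fun _ => _) = (fun z : C => -1 * q0.[z])); last first.
    by apply/funext => z; rewrite mulN1r.
  by apply: smoothM; [exact: smooth_cst|exact: smooth_poly].
move: (evtI (evt_neq0 (smooth_continuous Qs) Q0) gP); apply: evtS => z /= [Qz].
rewrite (_ : P = p0%:P + Q * ('X - (g a)%:P%:P)); last by rewrite -PQ subrKC.
rewrite hornerD hornerC hornerM hornerXsubC p0q !(hornerD, hornerM, hornerN, hornerC, hornerX).
move=> H; apply: (mulfI Qz); apply/eqP; rewrite -subr_eq0; apply/eqP.
rewrite -[RHS]H mulrDr.
rewrite (_ : Q.[(g z)%:P].[z] * ((z - a) * (- q0.[z] / Q.[(g z)%:P].[z])) = - ((z-a) * q0.[z])); last by field.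
ring.
Qed.

End ComplexPlane.

(** * The maximum principle *)

Section MaximumPrinciple.
Variable R : realType.
Local Notation C := (R[i]^o).
Local Notation Re := complex.Re.
Local Notation Im := complex.Im.
Implicit Types (z w a b : C) (h k g H : C -> C) (E D P Q : set C).

Definition nsq z : R := Re z ^+ 2 + Im z ^+ 2.

Lemma nsqE z : nsq z = normc z ^+ 2.
Proof. by case: z => x y; rewrite /nsq /= sqr_sqrtr // addr_ge0 ?sqr_ge0. Qed.

Lemma Re_le_normc z : `|Re z| <= normc z.
Proof.
case: z => x y /=; rewrite -sqrtr_sqr ler_sqrt ?lerDl ?sqr_ge0 // addr_ge0 ?sqr_ge0 //.
Qed.

Lemma Im_le_normc z : `|Im z| <= normc z.
Proof.
case: z => x y /=; rewrite -sqrtr_sqr ler_sqrt ?lerDr ?sqr_ge0 // addr_ge0 ?sqr_ge0 //.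
Qed.

Lemma normc_real (x : R) : normc x%:C = `|x|.
Proof. by rewrite /= expr0n addr0 sqrtr_sqr. Qed.

Lemma cReD z w : Re (z + w) = Re z + Re w. Proof. by case: z; case: w. Qed.
Lemma cImD z w : Im (z + w) = Im z + Im w. Proof. by case: z; case: w. Qed.
Lemma cReB z w : Re (z - w) = Re z - Re w. Proof. by case: z; case: w. Qed.
Lemma cImB z w : Im (z - w) = Im z - Im w. Proof. by case: z; case: w. Qed.
Lemma cReM z w : Re (z * w) = Re z * Re w - Im z * Im w.
Proof. by case: z; case: w. Qed.
Lemma cImM z w : Im (z * w) = Re z * Im w + Im z * Re w.
Proof. by case: z => x y; case: w => u v. Qed.

Lemma continuous_Re : continuous (fun z : C => Re z).
Proof.
move=> a; apply/(@cvgrPdist_lt _ _ _ _ (nbhs_filter a)) => e e0.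
apply/evtE; exists e => // z /=; apply: le_lt_trans.
by rewrite -cReB; apply: le_trans (Re_le_normc _) _; rewrite normcB.
Qed.

Lemma continuous_Im : continuous (fun z : C => Im z).
Proof.
move=> a; apply/(@cvgrPdist_lt _ _ _ _ (nbhs_filter a)) => e e0.
apply/evtE; exists e => // z /=; apply: le_lt_trans.
by rewrite -cImB; apply: le_trans (Im_le_normc _) _; rewrite normcB.
Qed.

Lemma continuous_nsq : continuous nsq.
Proof.
move=> a; have cR := @continuous_Re a; have cI := @continuous_Im a.
exact: (continuousD (continuousM cR cR) (continuousM cI cI)).
Qed.

Lemma continuous_real_complex : continuous (fun x : R => x%:C : C).
Proof.
move=> x; apply/cvgrPdist_lt => -[e e'].
rewrite ltcE /= => /andP[/eqP -> e0].
near=> y; rewrite (_ : x%:C - y%:C = (x - y)%:C); last by rewrite rmorphB.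
rewrite norm_normc normc_real -[ltRHS]/(e%:C) ltcR.
by near: y; exact: cvgr_dist_lt.
Unshelve. all: by end_near. Qed.

(** The mean over the four points exceeds the central value by exactly t^2. This strict excess lets
    the penalty [e * nsq z] beat the remainder terms. *)
Lemma nsq_four_points c (t : R) :
  nsq (c + t%:C * 1) + nsq (c + t%:C * -1) + nsq (c + t%:C * (0 +i* 1)) +
  nsq (c + t%:C * - (0 +i* 1)) = 4%:R * nsq c + 4%:R * t ^+ 2.
Proof. by rewrite /nsq; case: c => x y /=; ring. Qed.

(* Averaging over the four points c + t i^k kills the first and second order
   terms of H, so that the average of |H|^2 is at least |H c|^2 up to o(t^2). *)
Lemma nsq_no_local_max H c (e : R) : smooth 2 H c -> 0 < e ->
  ~ evt c [set z | nsq (H z) + e * nsq z <= nsq (H c) + e * nsq c].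
Proof.
move=> [h1 hE [h2 h1E /continuous_evt h2c]] e0 hmax.
(* Each remainder has real and imaginary parts at most d t^2, so with d = e / (4 S) the four
   together cost less than 2 e t^2, against the 4 e t^2 gained from the penalty. The 1 in [S] keeps
   it positive when [A = 0]. *)
pose A := H c; pose S := `|Re A| + `|Im A| + 1.
have S0 : 0 < S by rewrite ltr_wpDl // addr_ge0.
pose d := e / (4%:R * S).
have d0 : 0 < d by rewrite divr_gt0 // mulr_gt0.
have [r r0 /= hr] := evtI hmax (evtI (evtI hE h1E) (h2c d d0)).
pose t := r / 2%:R; have t0 : 0 < t by rewrite divr_gt0.
pose ic : C := 0 +i* 1; have ic2 : ic ^+ 2 = -1 by exact: sqr_i.
have key (s : C) : normc s = 1 ->
    exists n : C, [/\ H (c + t%:C * s) = A + t%:C * s * h1 c + (t%:C * s) ^+ 2 * (h2 c + n),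
      `|Re n| <= d, `|Im n| <= d &
      nsq (H (c + t%:C * s)) + e * nsq (c + t%:C * s) <= nsq A + e * nsq c].
  move=> s1; have [|hm [[hH hh1] hd]] := hr (c + t%:C * s).
    rewrite addrAC subrr add0r normcM s1 mulr1 normc_real.
    by rewrite ger0_norm ?ltW // /t ltr_pdivrMr // ltr_pMr // ltr1n.
  exists (h2 (c + t%:C * s) - h2 c); split => //.
  - rewrite hH hh1 addrAC subrr add0r -/A; ring.
  - exact: le_trans (Re_le_normc _) (ltW hd).
  - exact: le_trans (Im_le_normc _) (ltW hd).
have [|n0 [E0 a0 b0 m0]] := key 1; first by rewrite normc1.
have [|n1 [E1 a1 b1 m1]] := key (-1); first by rewrite normcN normc1.
have [|n2 [E2 a2 b2 m2]] := key ic.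
  by rewrite /= expr0n expr1n add0r sqrtr1.
have [|n3 [E3 a3 b3 m3]] := key (- ic).
  by rewrite normcN /= expr0n expr1n add0r sqrtr1.
(* Dropping the square of [u] leaves a bound linear in [u], so the four bounds add up and the
   cancellation in the sum of the [U] applies. *)
have lowS (u : C) : nsq A + 2%:R * (Re A * Re u + Im A * Im u) <= nsq (A + u).
  rewrite /nsq cReD cImD; have := sqr_ge0 (Re u); have := sqr_ge0 (Im u); nra.
pose U (s n : C) := t%:C * s * h1 c + (t%:C * s) ^+ 2 * (h2 c + n).
have {}E0 : H (c + t%:C * 1) = A + U 1 n0 by rewrite E0 /U addrA.
have {}E1 : H (c + t%:C * -1) = A + U (-1) n1 by rewrite E1 /U addrA.
have {}E2 : H (c + t%:C * ic) = A + U ic n2 by rewrite E2 /U addrA.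
have {}E3 : H (c + t%:C * - ic) = A + U (- ic) n3 by rewrite E3 /U addrA.
have UE : U 1 n0 + U (-1) n1 + U ic n2 + U (- ic) n3 =
    (t ^+ 2)%:C * (n0 + n1 - n2 - n3).
  rewrite (_ : (t ^+ 2)%:C = t%:C ^+ 2); last by rewrite rmorphXn.
  rewrite /U !exprMn !sqrrN ic2 expr1n; ring.
have UR : Re (U 1 n0) + Re (U (-1) n1) + Re (U ic n2) + Re (U (- ic) n3) =
    t ^+ 2 * (Re n0 + Re n1 - Re n2 - Re n3).
  by rewrite -!cReD UE cReM mul0r subr0 !(cReB, cReD).
have UI : Im (U 1 n0) + Im (U (-1) n1) + Im (U ic n2) + Im (U (- ic) n3) =
    t ^+ 2 * (Im n0 + Im n1 - Im n2 - Im n3).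
  by rewrite -!cImD UE cImM mul0r addr0 !(cImB, cImD).
have N0 := nsq_four_points c t.
have L0 := lowS (U 1 n0); have L1 := lowS (U (-1) n1).
have L2 := lowS (U ic n2); have L3 := lowS (U (- ic) n3).
rewrite -E0 in L0; rewrite -E1 in L1; rewrite -E2 in L2; rewrite -E3 in L3.
have B1 : - (4%:R * d * `|Re A|) <= Re A * (Re n0 + Re n1 - Re n2 - Re n3).
  rewrite lerNl -mulrN mulrC; apply: le_trans (ler_norm _) _.
  rewrite normrM ler_wpM2r // normrN.
  move: a0 a1 a2 a3; rewrite !ler_norml => /andP[? ?] /andP[? ?] /andP[? ?] /andP[? ?].
  by apply/andP; split; lra.
have B2 : - (4%:R * d * `|Im A|) <= Im A * (Im n0 + Im n1 - Im n2 - Im n3).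
  rewrite lerNl -mulrN mulrC; apply: le_trans (ler_norm _) _.
  rewrite normrM ler_wpM2r // normrN.
  move: b0 b1 b2 b3; rewrite !ler_norml => /andP[? ?] /andP[? ?] /andP[? ?] /andP[? ?].
  by apply/andP; split; lra.
have dS : 4%:R * d * S = e.
  by rewrite /d; field; rewrite gt_eqF.
have t2 : 0 < t ^+ 2 by rewrite exprn_gt0.
have T1 : t ^+ 2 * - (4%:R * d * `|Re A| + 4%:R * d * `|Im A|) <=
   Re A * (t ^+ 2 * (Re n0 + Re n1 - Re n2 - Re n3)) +
   Im A * (t ^+ 2 * (Im n0 + Im n1 - Im n2 - Im n3)).
  rewrite (mulrCA (Re A)) (mulrCA (Im A)) -!mulrDr ler_pM2l //; lra.
have T2 : t ^+ 2 * (4%:R * d * `|Re A| + 4%:R * d * `|Im A|) < t ^+ 2 * e.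
  rewrite ltr_pM2l // -dS /S; lra.
rewrite -UR -UI in T1.
have EN : e * (nsq (c + t%:C * 1) + nsq (c + t%:C * -1) + nsq (c + t%:C * ic) +
    nsq (c + t%:C * - ic)) = e * (4%:R * nsq c) + 4%:R * (t ^+ 2 * e).
  by rewrite N0; ring.
have et : 0 < t ^+ 2 * e by rewrite mulr_gt0.
nra.
Qed.

End MaximumPrinciple.

(** * Liouville's theorem with exceptional points *)

Section Liouville.
Variable R : realType.
Local Notation C := (R[i]^o).
Local Notation Re := complex.Re.
Local Notation Im := complex.Im.
Implicit Types (z w a b : C) (h k g H : C -> C) (E D P Q : set C).

(** Squares stand in for discs: they are images of products of two segments, whence compact, and are
    comparable to discs up to a factor 2. *)
Definition square (r : R) : set C := [set z | `|Re z| <= r /\ `|Im z| <= r].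

Definition square_int (r : R) : set C := [set z | `|Re z| < r /\ `|Im z| < r].

Lemma square_int_open r z : square_int r z -> evt z (square_int r).
Proof.
move=> [z1 z2]; exists (Num.min (r - `|Re z|) (r - `|Im z|)).
  by rewrite lt_min !subr_gt0 z1.
move=> w; rewrite lt_min => /andP[w1 w2]; split.
  have -> : Re w = Re z + Re (w - z) by rewrite cReB subrKC.
  apply: le_lt_trans (ler_normD _ _) _; rewrite -ltrBrDl.
  exact: le_lt_trans (Re_le_normc _) w1.
have -> : Im w = Im z + Im (w - z) by rewrite cImB subrKC.
apply: le_lt_trans (ler_normD _ _) _; rewrite -ltrBrDl.
exact: le_lt_trans (Im_le_normc _) w2.
Qed.

Lemma complexRI z : z = (Re z)%:C + (0 +i* 1) * (Im z)%:C.
Proof.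
case: z => x y; apply/eqP; rewrite eq_complex /=.
by apply/andP; split; apply/eqP; ring.
Qed.

Lemma square_compact (r : R) : compact (square r).
Proof.
pose J (p : R * R) : C := p.1 +i* p.2.
have -> : square r = J @` (`[- r, r] `*` `[- r, r]).
  apply/seteqP; split => [z [z1 z2]|y [p [/=]]].
    exists (Re z, Im z); last by rewrite [LHS]complexRI [RHS]complexRI.
    by split; rewrite /= in_itv /= -ler_norml.
  by rewrite !in_itv /= -!ler_norml => p1 p2 <-.
apply: continuous_compact; last by apply: compact_setX; exact: segment_compact.
apply: continuous_subspaceT.
have -> : J = (fun p => p.1%:C + (0 +i* 1) * p.2%:C).
  by apply/funext => p; rewrite [LHS]complexRI.
move=> p.
have c1 : {for p, continuous (fun p : R * R => p.1%:C : C)}.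
  apply: (@continuous_comp _ _ _ (@fst R R)); first exact: cvg_fst.
  exact: continuous_real_complex.
have c2 : {for p, continuous (fun p : R * R => p.2%:C : C)}.
  apply: (@continuous_comp _ _ _ (@snd R R)); first exact: cvg_snd.
  exact: continuous_real_complex.
have c3 : {for p, continuous (fun p : R * R => (0 +i* 1) : C)}.
  exact: cst_continuous.
exact: (continuousD c1 (continuousM c3 c2)).
Qed.

Lemma square_EVT_max (r : R) (u : C -> R) : 0 <= r ->
  (forall z, square r z -> {for z, continuous u}) ->
  exists2 c, square r c & forall z, square r z -> u z <= u c.
Proof.
move=> r0 uc.
have [||| c cA cmax] := @compact_EVT_max _ R u (square r).
- by exists 0; split; rewrite /= normr0.
- exact: square_compact.
- by apply: continuous_in_subspaceT => z; rewrite inE; exact: uc.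
exists c; first by rewrite inE in cA.
by move=> z zr; apply: cmax; rewrite inE.
Qed.

(** Adding [e * nsq z] to the squared modulus forces its maximum onto the boundary or onto a zero of
    [H]; then e tends to 0. The alternative [H z = 0] accommodates exceptional points, where only
    continuity is available. *)
Lemma max_principle H (r M : R) : 0 <= r -> 0 <= M ->
  (forall z, square r z -> {for z, continuous H}) ->
  (forall z, square_int r z -> H z = 0 \/ smooth 2 H z) ->
  (forall z, square r z -> ~ square_int r z -> normc (H z) <= M) ->
  forall z, square r z -> normc (H z) <= M.
Proof.
move=> r0 M0 Hc Hs Hb z zr.
have nsqr w : square r w -> nsq w <= 2%:R * r ^+ 2.
  move=> [w1 w2]; rewrite /nsq -(real_normK (num_real (Re w))).
  rewrite -(real_normK (num_real (Im w))).
  have := normr_ge0 (Re w); have := normr_ge0 (Im w); nra.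
have nsq0 w : 0 <= nsq w by rewrite addr_ge0 ?sqr_ge0.
rewrite -ler_sqr ?nnegrE ?normc_ge0 // -nsqE.
suff He (e : R) : 0 < e -> nsq (H z) <= M ^+ 2 + e * (2%:R * r ^+ 2).
  apply/ler_addgt0Pr => d d0.
  have := He (d / (2%:R * r ^+ 2 + 1)).
  have k0 : 0 < 2%:R * r ^+ 2 + 1 by have := sqr_ge0 r; lra.
  rewrite divr_gt0 // => /(_ isT) /le_trans; apply; rewrite lerD2l.
  rewrite mulrAC ler_pdivrMr // ler_wpM2l ?ltW //; lra.
move=> e0.
have [|c cr cmax] := @square_EVT_max r (fun w => nsq (H w) + e * nsq w) r0.
  move=> w wr.
  have c1 : {for w, continuous (fun w => nsq (H w))}.
    by apply: continuous_comp; [exact: Hc|exact: continuous_nsq].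
  have c2 : {for w, continuous (fun w : C => e)} by exact: cst_continuous.
  exact: (continuousD c1 (continuousM c2 (@continuous_nsq R w))).
have B : nsq (H z) <= nsq (H c) + e * (2%:R * r ^+ 2).
  apply: (@le_trans _ _ (nsq (H z) + e * nsq z)).
    by rewrite lerDl mulr_ge0 // ltW.
  by apply: le_trans (cmax z zr) _; rewrite lerD2l; apply: ler_wpM2l; [exact: ltW|exact: nsqr].
apply: le_trans B _; rewrite lerD2r.
have [ci|ci] := pselect (square_int r c); last first.
  by rewrite nsqE ler_sqr ?nnegrE ?normc_ge0 //; exact: Hb.
have [->|Hs2] := Hs c ci.
  by rewrite nsqE normc0 expr0n sqr_ge0.
exfalso; apply: (nsq_no_local_max Hs2 e0).
move: (square_int_open ci); apply: evtS => w [w1 w2].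
by apply: cmax; split; exact: ltW.
Qed.

Definition locally_finite E :=
  forall r : R, exists s : seq C, forall z, E z -> normc z <= r -> z \in s.

(** Keeping the list inside [E] ensures that the monic polynomial with these roots does not vanish
    off [E]. *)
Lemma locally_finite_sub E (r : R) : locally_finite E -> exists s : seq C,
  (forall z, E z -> normc z <= r -> z \in s) /\ (forall z, z \in s -> E z).
Proof.
move=> /(_ r)[s sE]; exists [seq z <- s | `[< E z >]]; split.
  by move=> z Ez zr; rewrite mem_filter sE // andbT; exact/asboolP.
by move=> z; rewrite mem_filter => /andP[/asboolP].
Qed.

Lemma locally_finite_evt E a : locally_finite E ->
  evt a [set z | E z -> z = a].
Proof.
move=> /(_ (normc a + 1))[s sE].
have [d d0 ds] : exists2 d : R, 0 < d & forall z, z \in s -> normc (z - a) < d -> z = a.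
  elim: s {sE} => [|b s [d d0 IH]]; first by exists 1.
  have [->|ba] := eqVneq b a.
    exists d => // z; rewrite inE => /orP[/eqP //|]; exact: IH.
  exists (Num.min d (normc (b - a))); first by rewrite lt_min d0 normc_gt0 subr_eq0.
  move=> z; rewrite inE lt_min => /orP[/eqP ->|zs] /andP[]; last by move=> ? _; exact: IH.
  by rewrite ltxx.
exists (Num.min 1 d); first by rewrite lt_min ltr01.
move=> z; rewrite lt_min => /andP[z1 zd] Ez; apply: ds => //; apply: sE => //.
rewrite (_ : z = a + (z - a)); last by rewrite subrKC.
by apply: le_trans (le_normcD _ _) _; rewrite lerD2l ltW.
Qed.

Lemma locally_finiteU E F : locally_finite E -> locally_finite F ->
  locally_finite (E `|` F).
Proof.
move=> HE HF r; have [s sE] := HE r; have [t tF] := HF r.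
exists (s ++ t) => z [/sE|/tF] H /H; rewrite mem_cat => ->; rewrite ?orbT //.
Qed.

Lemma locally_finite1 a : locally_finite [set a].
Proof. by move=> r; exists [:: a] => z -> _; rewrite inE. Qed.

Lemma locally_finite_roots (p : {poly R[i]}) : p != 0 ->
  locally_finite [set z | p.[z] = 0].
Proof.
have [s ->] := closed_field_poly_normal p.
rewrite scaler_eq0 negb_or => /andP[lp _] r; exists s => z /= /eqP.
rewrite hornerZ mulf_eq0 (negbTE lp) /= => + _.
by rewrite -[_ == 0]/(root _ _) root_prod_XsubC.
Qed.

Lemma normc_le_square r z : square r z -> normc z <= 2%:R * r.
Proof.
move=> [z1 z2]; have r0 : 0 <= r by apply: le_trans z1.
rewrite [z]complexRI; apply: le_trans (le_normcD _ _) _.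
rewrite normcM !normc_real /= expr0n expr1n add0r sqrtr1 mul1r.
by rewrite mulr_natl mulr2n lerD.
Qed.

Lemma square_normc r z : normc z <= r -> square r z.
Proof. by move=> zr; split; apply: le_trans zr; [exact: Re_le_normc|exact: Im_le_normc]. Qed.

Lemma square_boundary r z : ~ square_int r z -> r <= normc z.
Proof.
move=> zr; rewrite leNgt; apply/negP => zr'; apply: zr.
by split; apply: le_lt_trans zr'; [exact: Re_le_normc|exact: Im_le_normc].
Qed.

Lemma poly_growth (p : {poly R[i]}) : exists (B : R) (n : nat), 0 <= B /\
  forall z, normc p.[z] <= B * (1 + normc z) ^+ n.
Proof.
elim/poly_ind: p => [|p c [B [n [B0 IH]]]].
  exists 0, 0%N; split => // z; by rewrite horner0 normc0 mul0r.
exists (B + normc c), n.+1; split; first by rewrite addr_ge0 ?normc_ge0.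
move=> z; rewrite hornerMXaddC; apply: le_trans (le_normcD _ _) _.
have z0 := normc_ge0 z.
rewrite mulrDl lerD //.
  rewrite normcM exprSr mulrA ler_pM ?normc_ge0 //; by rewrite lerDr.
by rewrite ler_peMr ?normc_ge0 // exprn_ege1 // lerDl.
Qed.

Lemma bernoulli (x : R) n : 0 <= x -> 1 + x *+ n <= (1 + x) ^+ n.
Proof.
move=> x0; elim: n => [|n IH]; first by rewrite mulr0n addr0 expr0.
rewrite exprS mulrS.
have : 0 <= x *+ n by rewrite mulrn_wge0.
nra.
Qed.

(** If x > M, the powers of x / M grow at least linearly by Bernoulli's inequality and outgrow every
    constant [K]. *)
Lemma le_of_expr_bounded (x M K : R) : 0 < M -> 0 <= x ->
  (forall n, x ^+ n <= K * M ^+ n) -> x <= M.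
Proof.
move=> M0 x0 H; rewrite leNgt; apply/negP => Mx.
pose y := x / M - 1.
have y0 : 0 < y by rewrite subr_gt0 ltr_pdivlMr // mul1r.
have Hy n : 1 + y *+ n <= K.
  apply: le_trans (bernoulli n (ltW y0)) _.
  by rewrite /y subrKC expr_div_n ler_pdivrMr ?exprn_gt0.
have K0 : 0 <= K by have := Hy 0%N; rewrite mulr0n addr0; exact: le_trans.
have := Hy (Num.bound (K / y)).
have := archi_boundP (divr_ge0 K0 (ltW y0)).
rewrite ltr_pdivrMr // -mulr_natl; lra.
Qed.

(* The maximum principle is applied to q * g ^ n, where q vanishes on the
   exceptional points in the square; then n tends to infinity. *)
Lemma max_principle_off E g (B r M : R) N : locally_finite E ->
  (forall z, ~ E z -> smooth 2 g z) -> 0 <= B ->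
  (forall z, normc (g z) <= B * (1 + normc z) ^+ N) ->
  0 <= r -> 0 < M ->
  (forall z, square r z -> ~ square_int r z -> normc (g z) <= M) ->
  forall z, square r z -> ~ E z -> normc (g z) <= M.
Proof.
move=> Elf gs B0 gB r0 M0 gM z zr zE.
have [s [sE Es]] := locally_finite_sub (2%:R * r) Elf.
pose q := \prod_(e <- s) ('X - e%:P).
have qE w : square r w -> E w -> q.[w] = 0.
  move=> wr Ew; apply/eqP; rewrite -[_ == 0]/(root _ _) root_prod_XsubC.
  by apply: sE => //; exact: normc_le_square.
have qz : q.[z] != 0.
  rewrite -[_ == 0]/(root _ _) root_prod_XsubC.
  by apply/negP => /Es.
have [Bq [m [Bq0 qB]]] := poly_growth q.
pose K := Bq * (1 + 2%:R * r) ^+ m.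
have K0 : 0 <= K by rewrite mulr_ge0 // exprn_ge0 // addr_ge0 // mulr_ge0.
have qK w : square r w -> normc q.[w] <= K.
  move=> wr; apply: le_trans (qB w) _; rewrite ler_wpM2l // lerXn2r //.
  - by rewrite nnegrE addr_ge0 ?normc_ge0.
  - by rewrite nnegrE addr_ge0 // mulr_ge0.
  - by rewrite lerD2l; exact: normc_le_square.
have key n : normc q.[z] * normc (g z) ^+ n <= K * M ^+ n.
  rewrite -normcX -normcM.
  apply: (@max_principle (fun w => q.[w] * g w ^+ n) r) => //.
  - by rewrite mulr_ge0 // exprn_ge0 // ltW.
  - move=> w wr; have [Ew|Ew] := pselect (E w); last first.
      apply: (@smooth_continuous _ 2); apply: smoothM; first exact: smooth_poly.
      by apply: smooth_exp; exact: gs.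
    (* At an exceptional point [q] tends to 0 while [g ^ n] is bounded by [L] on the unit disc
       around [w], so the product is continuous there with value 0. *)
    apply/continuous_evt => e e0; rewrite (qE w wr Ew) mul0r.
    pose L := (B * (2%:R + normc w) ^+ N) ^+ n + 1.
    have L0 : 0 < L.
      by rewrite ltr_wpDl // exprn_ge0 // mulr_ge0 // exprn_ge0 // addr_ge0 ?normc_ge0.
    have /continuous_evt qc : {for w, continuous (fun w : C => q.[w] : C)}.
      exact: (@smooth_continuous _ 0 _ _ (smooth_poly _ _ _)).
    have [d d0 dP] := qc (e / L) (divr_gt0 e0 L0).
    exists (Num.min 1 d); first by rewrite lt_min ltr01.
    move=> u; rewrite lt_min => /andP[u1 ud] /=; rewrite subr0 normcM normcX.
    have := dP u ud => /=; rewrite (qE w wr Ew) subr0 ltr_pdivlMr // => ueL.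
    apply: le_lt_trans ueL; rewrite ler_wpM2l ?normc_ge0 //.
    rewrite /L -[leLHS]addr0 lerD // lerXn2r ?nnegrE ?normc_ge0 //.
      by rewrite mulr_ge0 // exprn_ge0 // addr_ge0 ?normc_ge0.
    apply: le_trans (gB u) _; rewrite ler_wpM2l // lerXn2r //.
    - by rewrite nnegrE addr_ge0 ?normc_ge0.
    - by rewrite nnegrE addr_ge0 ?normc_ge0.
    rewrite (_ : u = w + (u - w)); last by rewrite subrKC.
    have := le_normcD w (u - w); lra.
  - move=> w [/ltW w1 /ltW w2]; have [Ew|Ew] := pselect (E w).
      by left; rewrite qE // mul0r.
    right; apply: smoothM; first exact: smooth_poly.
    by apply: smooth_exp; exact: gs.
  - move=> w wr wi; rewrite normcM normcX ler_pM ?normc_ge0 ?exprn_ge0 ?normc_ge0 //.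
      exact: qK.
    by rewrite lerXn2r ?nnegrE ?normc_ge0 ?(ltW M0) //; exact: gM.
apply: (@le_of_expr_bounded _ _ (K / normc q.[z])) => //; first exact: normc_ge0.
move=> n; rewrite mulrAC ler_pdivlMr ?normc_gt0 // mulrC; exact: key.
Qed.

(** On the boundary of a square of half-side r, g is at most B / (1 + r). Taking r = |z| + B / e
    encloses [z] and makes this bound at most e. *)
Lemma vanishing_of_decay E g (B : R) : locally_finite E ->
  (forall z, ~ E z -> smooth 2 g z) ->
  (forall z, normc (g z) * (1 + normc z) <= B) ->
  forall z, ~ E z -> g z = 0.
Proof.
move=> Elf gs gB z zE; have z0 := normc_ge0 z.
have B0 : 0 <= B by apply: le_trans (gB 0); rewrite mulr_ge0 ?addr_ge0 ?normc_ge0.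
apply/eqP; rewrite -normc_neq0 eq_le normc_ge0 andbT.
apply/ler_addgt0Pr => e e0; rewrite add0r.
pose r := normc z + B / e.
have r0 : 0 <= r by rewrite addr_ge0 // divr_ge0 // ltW.
apply: (@max_principle_off E g B r e 0) => //.
- move=> w; rewrite expr0 mulr1; apply: le_trans (gB w).
  by rewrite ler_peMr ?normc_ge0 // lerDl normc_ge0.
- move=> w _ /square_boundary wr.
  rewrite -(@ler_pM2r _ (1 + normc w)) ?ltr_wpDr ?normc_ge0 //.
  apply: le_trans (gB w) _; rewrite mulrC -ler_pdivrMr //.
  rewrite /r in wr; lra.
- by apply: square_normc; rewrite lerDl divr_ge0 // ltW.
Qed.

(* Divided differences lower the growth exponent by one. *)
Lemma liouville E g (B : R) N : locally_finite E ->
  (forall z, ~ E z -> smooth 2 g z) ->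
  (forall z, normc (g z) * (1 + normc z) <= B * (1 + normc z) ^+ N) ->
  exists p : {poly R[i]}, forall z, ~ E z -> g z = p.[z].
Proof.
(* The extra factor 1 + |z| in the bound shifts the exponent, so that [N = 0] is the decaying case
   and yields the zero polynomial. *)
elim: N E g B => [|N IH] E g B Elf gs gB.
  exists 0 => z zE; rewrite horner0; apply: (vanishing_of_decay Elf gs _ zE).
  by move=> w; have := gB w; rewrite expr0 mulr1; apply.
have [b bE] : exists b, ~ E b.
  have [d d0 dE] := locally_finite_evt 0 Elf.
  exists (d / 2%:R)%:C => /dE.
  have h0 : 0 < d / 2%:R by rewrite divr_gt0.
  rewrite subr0 normc_real gtr0_norm // ltr_pdivrMr // ltr_pMr // ltr1n.
  move=> /(_ isT) /eqP; rewrite eq_complex /= => /andP[/eqP h _].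
  by rewrite h ltxx in h0.
(* The value 0 at [b] is arbitrary; [b] joins the exceptional set in the recursive call. *)
pose k (z : C) : C := if z == b then 0 else (g z - g b) / (z - b).
have [h1 hE h1s] := gs b bE.
have /continuous_evt h1c := @smooth_continuous _ 1 _ _ h1s.
have [d d0 hd] := evtI hE (h1c 1 ltr01).
pose B0 := Num.max B 0.
have B00 : 0 <= B0 by rewrite le_max lexx orbT.
have gB0 z : normc (g z) <= B0 * (1 + normc z) ^+ N.
  have p0 : 0 < 1 + normc z by rewrite ltr_wpDr ?normc_ge0.
  rewrite -(@ler_pM2r _ (1 + normc z)) // -mulrA -exprSr.
  apply: le_trans (gB z) _; apply: ler_wpM2r; first by rewrite exprn_ge0 // ltW.
  by rewrite le_max lexx.
(* When |z - b| >= d one has 1 + |z| <= c |z - b|, so dividing by z - b gains one power; this gives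
   [K2]. Within distance [d] of [b] the quotient is [h1], bounded by |h1(b)| + 1; this gives
   [K1]. *)
pose c := (1 + normc b + d) / d.
have c0 : 0 <= c by rewrite divr_ge0 ?addr_ge0 ?normc_ge0 // ltW.
pose K1 := (normc (h1 b) + 1) * (1 + normc b + d).
pose K2 := (B0 + normc (g b)) * c.
have nz z : 1 <= 1 + normc z by rewrite lerDl normc_ge0.
have K10 : 0 <= K1.
  by rewrite mulr_ge0 ?addr_ge0 ?normc_ge0 // ltW.
have K20 : 0 <= K2 by rewrite mulr_ge0 // addr_ge0 ?normc_ge0.
have kB z : normc (k z) * (1 + normc z) <= (K1 + K2) * (1 + normc z) ^+ N.
  have zN : 1 <= (1 + normc z) ^+ N by rewrite exprn_ege1.
  rewrite /k; case: eqP => [_|/eqP zb].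
    rewrite normc0 mul0r mulr_ge0 ?addr_ge0 // (le_trans _ zN) //.
  have zb0 : z - b != 0 by rewrite subr_eq0.
  have zbz : normc z <= normc b + normc (z - b).
    by have := le_normcD b (z - b); rewrite subrKC.
  have [zd|zd] := ltP (normc (z - b)) d.
    have [hz hc] := hd z zd.
    have -> : (g z - g b) / (z - b) = h1 z.
      by rewrite /= in hz; rewrite hz addrAC subrr add0r mulrC mulKf.
    rewrite -[leLHS]mulr1; apply: ler_pM => //.
    - by rewrite mulr_ge0 ?normc_ge0 // (le_trans _ (nz z)).
    - rewrite (le_trans _ (_ : K1 <= _)) ?lerDl // /K1; apply: ler_pM; rewrite ?normc_ge0 //.
      + by rewrite (le_trans _ (nz z)).
      + have := le_normcD (h1 b) (h1 z - h1 b); rewrite subrKC; move: hc => /=; lra.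
      + lra.
  have zc : 1 + normc z <= c * normc (z - b).
    rewrite /c mulrAC ler_pdivlMr //.
    have := normc_ge0 b; nra.
  rewrite normcM normcV mulrAC ler_pdivrMr ?normc_gt0 //.
  have gg : normc (g z - g b) <= (B0 + normc (g b)) * (1 + normc z) ^+ N.
    apply: le_trans (le_normcD _ _) _; rewrite normcN mulrDl lerD //.
    by rewrite ler_peMr ?normc_ge0.
  apply: (@le_trans _ _ ((B0 + normc (g b)) * (1 + normc z) ^+ N * (c * normc (z - b)))).
    by apply: ler_pM; rewrite ?normc_ge0 // (le_trans _ (nz z)).
  rewrite (_ : _ * (c * _) = K2 * (1 + normc z) ^+ N * normc (z - b)); last by rewrite /K2; ring.
  rewrite ler_wpM2r ?normc_ge0 // ler_wpM2r ?(le_trans _ zN) // lerDr //.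
have [|p kp] := IH (E `|` [set b]) k _ (locally_finiteU Elf (locally_finite1 b)) _ kB.
  move=> z /not_orP[zE zb']; have zb : z != b by apply/eqP.
  have [e e0 eP] := locally_finite_evt z (locally_finite1 b).
  apply: (@smooth_near _ _ (fun w => (g w - g b) * (w - b)^-1)).
    exists e => // w /eP /= wb; rewrite /k; case: eqP => // wb'.
    by have := wb wb'; rewrite wb' => bz; rewrite bz eqxx in zb.
  apply: smoothM; first by apply: smoothD; [exact: gs|exact: smooth_cst].
  apply: smoothV; first by rewrite subr_eq0.
  by apply: smoothD; [exact: smooth_id|exact: smooth_cst].
exists ((g b)%:P + ('X - b%:P) * p) => z zE.
rewrite hornerD hornerC hornerM hornerXsubC.
have [->|zb] := eqVneq z b; first by rewrite subrr mul0r addr0.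
rewrite -kp; last by move=> [//|/= /eqP]; exact/negP.
by rewrite /k (negbTE zb) mulrC divfK ?subr_eq0 // subrKC.
Qed.

End Liouville.

(** * Connectedness off a locally finite set *)

Section Continuation.
Variable R : realType.
Local Notation C := (R[i]^o).
Local Notation Re := complex.Re.
Local Notation Im := complex.Im.
Implicit Types (z w a b : C) (h k g H : C -> C) (E D A B U V : set C).

Lemma evt_other a (P : set C) : evt a P -> exists2 w, w != a & P w.
Proof.
move=> [d d0 dP]; have d2 : 0 < d / 2%:R by rewrite divr_gt0.
have nd : normc (d / 2%:R)%:C = d / 2%:R by rewrite normc_real gtr0_norm.
exists (a + (d / 2%:R)%:C); last first.
  by apply: dP; rewrite addrAC subrr add0r nd ltr_pdivrMr // ltr_pMr // ltr1n.
by rewrite -subr_eq0 addrAC subrr add0r -normc_neq0 nd gt_eqF.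
Qed.

Lemma locally_finite_evtC E a : locally_finite E -> ~ E a ->
  evt a (~` E).
Proof.
move=> Elf Ea; move: (locally_finite_evt a Elf); apply: evtS => z /= zE Ez.
by apply: Ea; rewrite -(zE Ez).
Qed.

Lemma locally_finite_other E a (P : set C) : locally_finite E -> evt a P ->
  exists2 w, ~ E w & P w.
Proof.
move=> /(@locally_finite_evt _ _ a) Ea aP.
have [w wa [Ew Pw]] := evt_other (evtI Ea aP).
by exists w => // /Ew wa'; rewrite wa' eqxx in wa.
Qed.

Lemma vanish_dense E h a : locally_finite E -> {for a, continuous h} ->
  evt a [set z | ~ E z -> h z = 0] -> h a = 0.
Proof.
move=> Elf hc ha; apply/eqP/negP => /negP h0.
have [w wE [hw hw0]] := locally_finite_other Elf (evtI ha (evt_neq0 hc h0)).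
by move: hw0 => /=; rewrite hw // eqxx.
Qed.

Lemma poly_vanish_evt (p : {poly R[i]}) a : evt a [set z | p.[z] = 0] -> p = 0.
Proof.
move=> pa; apply/eqP/negP => /negP p0.
by have [w] := locally_finite_other (locally_finite_roots p0) pa.
Qed.

Lemma small_avoiding (s : seq R) (d : R) : 0 < d ->
  exists x, [/\ 0 < x, x < d & x \notin s].
Proof.
move=> d0; suff [e e0 es] : exists2 e, 0 < e & forall x, 0 < x -> x < e -> x \notin s.
  pose x := Num.min d e / 2%:R.
  have m0 : 0 < Num.min d e by rewrite lt_min d0.
  have x0 : 0 < x by rewrite divr_gt0.
  have : x < Num.min d e by rewrite ltr_pdivrMr // ltr_pMr // ltr1n.
  rewrite lt_min => /andP[xd xe]; exists x; split => //; exact: es.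
elim: s => [|y s [e e0 IH]]; first by exists 1.
have [y0|y0] := leP y 0.
  exists e => // x x0 xe; rewrite inE negb_or IH // andbT gt_eqF //.
  exact: le_lt_trans x0.
exists (Num.min e y); first by rewrite lt_min e0.
move=> x x0; rewrite lt_min => /andP[xe xy].
by rewrite inE negb_or IH // andbT lt_eqF.
Qed.

Definition segment_pt a b (t : R) : C := a + t%:C * (b - a).

Lemma segment_pt_continuous a b : continuous (segment_pt a b).
Proof.
move=> t; have c1 : {for t, continuous (fun _ : R => a)} by exact: cst_continuous.
have c2 : {for t, continuous (fun _ : R => b - a)} by exact: cst_continuous.
exact: (continuousD c1 (continuousM (@continuous_real_complex R t) c2)).
Qed.

(** The traces of [A] and [B] on the segment are complementary open sets, so the trace of [A] is
    both open and closed in the connected interval. *)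
Lemma segment_transfer A B a b : open A -> open B ->
  (forall t, 0 <= t <= 1 -> A (segment_pt a b t) \/ B (segment_pt a b t)) ->
  (forall t, 0 <= t <= 1 -> ~ (A (segment_pt a b t) /\ B (segment_pt a b t))) ->
  A a -> A b.
Proof.
move=> Ao Bo AB AB0 Aa.
have s0 : segment_pt a b 0 = a by rewrite /segment_pt mul0r addr0.
have s1 : segment_pt a b 1 = b by rewrite /segment_pt mul1r subrKC.
have opre V : open V -> open (segment_pt a b @^-1` V).
  by apply: open_comp => t _; exact: segment_pt_continuous.
have I01 (t : R) : `[0, 1]%classic t <-> 0 <= t <= 1 by rewrite /= in_itv.
have := @segment_connected R 0 1 (`[0, 1] `&` (segment_pt a b @^-1` A)).
have -> : A b = (`[0, 1] `&` (segment_pt a b @^-1` A)) 1.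
  apply/propext; split; first by move=> Ab; split; [rewrite I01 ler01 lexx|rewrite /= s1].
  by case; rewrite /= s1.
move=> ->; first by rewrite I01 ler01 lexx.
- by exists 0; split; [rewrite I01 ler01 lexx|rewrite /= s0].
- by exists (segment_pt a b @^-1` A) => //; exact: opre.
exists (~` (segment_pt a b @^-1` B)); first exact/open_closedC/opre.
apply/seteqP; split => t [] /I01 t01 /= tA; split; first exact/I01.
- by move=> tB; exact: (AB0 t t01).
- exact/I01.
- by have [] := AB t t01.
Qed.

Definition segment_closed U := forall a b t, U a -> U b -> 0 <= t <= 1 ->
  U (segment_pt a b t).

(** The apex [mid s] runs along the perpendicular bisector of a and b, near the midpoint. In the
    coordinate W = (e - a) / (b - a) it is 1/2 + i s, and a point e other than a and b lies on the
    first leg only if s = Im W / (2 Re W), on the second only if s = Im W / (2 (1 - Re W)). Only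
    finitely many e are within reach, so some small s avoids them all. *)
Lemma segment_avoiding E U a b : locally_finite E -> open U -> segment_closed U ->
  U a -> U b -> ~ E a -> ~ E b -> a != b ->
  exists m, U m /\ forall t, 0 <= t <= 1 ->
    ~ E (segment_pt a m t) /\ ~ E (segment_pt m b t).
Proof.
move=> Elf /open_evt Uo Uc Ua Ub Ea Eb ab.
have ab0 : b - a != 0 by rewrite subr_eq0 eq_sym.
pose ic : C := 0 +i* 1.
pose mid (s : R) : C := a + (b - a) * ((2%:R^-1)%:C + ic * s%:C).
have mid0 : U (mid 0).
  have := Uc a b 2%:R^-1 Ua Ub; rewrite /segment_pt /mid mulr0 addr0 mulrC; apply.
  by rewrite invr_ge0 ler0n invf_le1 // ler1n.
have [d d0 dU] := Uo _ mid0.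
have nab : 0 < normc (b - a) by rewrite normc_gt0.
have midU s : 0 < s -> s < d / normc (b - a) -> U (mid s).
  move=> s0 sd; apply: dU.
  have -> : mid s - mid 0 = (b - a) * (ic * s%:C).
    by rewrite /mid (_ : 0%:C = 0) //; ring.
  rewrite !normcM normc_real (gtr0_norm s0) /= expr0n expr1n add0r sqrtr1 mul1r.
  by rewrite mulrC -ltr_pdivlMr.
(* On both legs the coordinate W stays in the square of half-side 1, so this radius covers them
   generously. *)
pose r := normc a + normc (b - a) * 4%:R.
have [l lE] := Elf r.
pose W (e : C) := (e - a) / (b - a).
pose l1 := [seq Im (W e) / (2%:R * Re (W e)) | e <- l].
pose l2 := [seq Im (W e) / (2%:R * (1 - Re (W e))) | e <- l].
have [|s [s0]] := @small_avoiding (l1 ++ l2) (Num.min 1 (d / normc (b - a))).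
  by rewrite lt_min ltr01 divr_gt0.
rewrite lt_min mem_cat negb_or => /andP[s1 sd] /andP[sl1 sl2].
exists (mid s); split; first exact: midU.
have pt (u v : R) : 0 <= u -> u <= 1 -> `|v| <= 1 ->
    E (a + (b - a) * (u +i* v)) ->
    [/\ a + (b - a) * (u +i* v) \in l, Re (W (a + (b - a) * (u +i* v))) = u &
        Im (W (a + (b - a) * (u +i* v))) = v].
  move=> u0 u1 v1 Eu.
  have -> : W (a + (b - a) * (u +i* v)) = u +i* v.
    by rewrite /W addrAC subrr add0r mulrC mulKf.
  split => //; apply: lE => //.
  apply: le_trans (le_normcD _ _) _; rewrite lerD2l normcM ler_pM2l //.
  apply: (le_trans (@normc_le_square R 1 _ _)); last by rewrite mulr1 ler_nat.
  by split; rewrite //= ger0_norm.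
move=> t /andP[t0 t1]; split.
  have -> : segment_pt a (mid s) t = a + (b - a) * ((t / 2%:R) +i* (t * s)).
    rewrite /segment_pt /mid (complexRI ((t / 2%:R) +i* (t * s))) -/ic /=.
    rewrite (_ : (t / 2%:R)%:C = t%:C * (2%:R^-1)%:C); last by rewrite rmorphM.
    rewrite (_ : (t * s)%:C = t%:C * s%:C); last by rewrite rmorphM.
    ring.
  move=> Ee; have [||| el eR eI] := pt _ _ _ _ _ Ee.
  - by rewrite divr_ge0.
  - by rewrite ler_pdivrMr // mul1r (le_trans t1) // ler1n.
  - rewrite ger0_norm; last by rewrite mulr_ge0 // ltW.
    by apply: mulr_ile1 => //; exact: ltW.
  (* At [t = 0] the quotient defining [l1] would divide by zero, but the point is then [a], which is
     not in [E]. *)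
  have [t00|t00] := eqVneq t 0.
    apply: Ea; move: Ee; rewrite t00 !mul0r.
    by rewrite (_ : 0 +i* 0 = 0 :> C) // mulr0 addr0.
  move/negP: sl1; apply; apply/mapP; eexists; first exact: el.
  by rewrite eR eI; field.
have -> : segment_pt (mid s) b t =
    a + (b - a) * ((1 - (1 - t) / 2%:R) +i* ((1 - t) * s)).
  rewrite /segment_pt /mid (complexRI ((1 - (1 - t) / 2%:R) +i* ((1 - t) * s))) -/ic /=.
  rewrite (_ : (1 - (1 - t) / 2%:R)%:C = 1 - (1 - t%:C) * (2%:R^-1)%:C); last first.
    by rewrite !(rmorphB, rmorphM, rmorph1).
  rewrite (_ : ((1 - t) * s)%:C = (1 - t%:C) * s%:C); last first.
    by rewrite !(rmorphB, rmorphM, rmorph1).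
  rewrite (_ : (2%:R^-1)%:C = 2%:R^-1); last by rewrite fmorphV rmorph_nat.
  by field.
move=> Ee; have [||| el eR eI] := pt _ _ _ _ _ Ee.
- lra.
- lra.
- rewrite ger0_norm; last by rewrite mulr_ge0 ?subr_ge0 // ltW.
  by apply: mulr_ile1; rewrite ?subr_ge0 ?gerBl // ltW.
have [t10|t10] := eqVneq t 1.
  apply: Eb; move: Ee; rewrite t10 !subrr !mul0r subr0.
  by rewrite (_ : 1 +i* 0 = 1 :> C) // mulr1 subrKC.
move/negP: sl2; apply; apply/mapP; eexists; first exact: el.
rewrite eR eI; field.
by apply: contraNneq t10 => h; apply/eqP; lra.
Qed.

Lemma connected_off E U A B : locally_finite E -> open U -> segment_closed U ->
  open A -> open B ->
  (forall z, U z -> ~ E z -> A z \/ B z) ->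
  (forall z, U z -> ~ E z -> ~ (A z /\ B z)) ->
  forall a b, U a -> ~ E a -> A a -> U b -> ~ E b -> A b.
Proof.
move=> Elf Uo Uc Ao Bo AB AB0 a b Ua Ea Aa Ub Eb.
have [<- //|ab] := eqVneq a b.
have [m [Um mE]] := segment_avoiding Elf Uo Uc Ua Ub Ea Eb ab.
apply: (@segment_transfer A B m b) => //.
- by move=> t t01; apply: AB; [exact: Uc|case: (mE t t01)].
- by move=> t t01; apply: AB0; [exact: Uc|case: (mE t t01)].
apply: (@segment_transfer A B a m) => //.
- by move=> t t01; apply: AB; [exact: Uc|case: (mE t t01)].
- by move=> t t01; apply: AB0; [exact: Uc|case: (mE t t01)].
Qed.

Definition disc a (d : R) : set C := [set z | normc (z - a) < d].

Lemma disc_open a d : open (disc a d).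
Proof.
apply/open_evt => z zd; exists (d - normc (z - a)); first by rewrite subr_gt0.
move=> w wz; rewrite /disc /= (_ : w - a = (w - z) + (z - a)); last by rewrite subrKA.
by apply: le_lt_trans (le_normcD _ _) _; rewrite -ltrBrDr.
Qed.

Lemma disc_convex a d : segment_closed (disc a d).
Proof.
move=> x y t; rewrite /disc /= => xd yd /andP[t0 t1].
have -> : segment_pt x y t - a = (1 - t)%:C * (x - a) + t%:C * (y - a).
  by rewrite /segment_pt (_ : (1 - t)%:C = 1 - t%:C) ?rmorphB ?rmorph1 //; ring.
apply: le_lt_trans (le_normcD _ _) _; rewrite !normcM !normc_real.
rewrite !ger0_norm ?subr_ge0 //.
pose m := Num.max (normc (x - a)) (normc (y - a)).
have xm : normc (x - a) <= m by rewrite le_max lexx.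
have ym : normc (y - a) <= m by rewrite le_max lexx orbT.
have md : m < d by rewrite gt_max xd.
nra.
Qed.

End Continuation.

(** * Complex Nash functions are rational *)

Section Nash.
Variable R : realType.
Local Notation C := (R[i]^o).
Local Notation K := R[i].
Implicit Types (z w a b : C) (E U : set C) (P Q : {poly {poly K}}).

(** For |w| > 1, solve for the top term and divide by |w|^(n-1). Keeping the factor [a n] avoids a
    division by the leading coefficient, which may vanish at some z. *)
Lemma lead_term_bound (n : nat) (a : nat -> K) (w : K) : (0 < n)%N ->
  \sum_(j < n.+1) a j * w ^+ j = 0 ->
  normc (a n * w) <= \sum_(j < n.+1) normc (a j).
Proof.
case: n => // n _; rewrite big_ord_recr /= => /eqP; rewrite addr_eq0 => /eqP H.
have normc_sum (m : nat) (u : 'I_m -> K) :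
    normc (\sum_(j < m) u j) <= \sum_(j < m) normc (u j).
  elim/big_rec2: _ => [|j x y _ xy]; first by rewrite normc0.
  by apply: le_trans (le_normcD _ _) _; rewrite lerD2l.
have [w1|w1] := leP (normc w) 1.
  rewrite normcM big_ord_recr /=; apply: (@le_trans _ _ (normc (a n.+1))).
    by rewrite ler_piMr ?normc_ge0.
  by rewrite lerDr sumr_ge0 // => j _; exact: normc_ge0.
have w0 : 0 < normc w by exact: lt_trans w1.
rewrite -(@ler_pM2r _ (normc w ^+ n)) ?exprn_gt0 //.
have -> : normc (a n.+1 * w) * normc w ^+ n = normc (- (a n.+1 * w ^+ n.+1)).
  by rewrite normcN exprS mulrA [RHS]normcM normcX.
rewrite -H; apply: le_trans (normc_sum _ _) _.
rewrite [in leRHS]big_ord_recr /= mulrDl mulr_suml -[leLHS]addr0 lerD //; last first.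
  by rewrite mulr_ge0 ?exprn_ge0 ?normc_ge0.
apply: ler_sum => j _; rewrite normcM ler_wpM2l ?normc_ge0 // normcX.
by apply: ler_weXn2l; [exact: ltW|rewrite -ltnS].
Qed.

Lemma poly_sum_growth (n : nat) (a : nat -> {poly K}) :
  exists (B : R) (N : nat), 0 <= B /\
  forall z : C, \sum_(j < n) normc (a j).[z] <= B * (1 + normc z) ^+ N.
Proof.
elim: n => [|n [B [N [B0 IH]]]].
  by exists 0, 0%N; split => // z; rewrite big_ord0 mul0r.
have [B' [N' [B0' H]]] := poly_growth (a n).
exists (B + B'), (N + N')%N; split; first by rewrite addr_ge0.
move=> z; rewrite big_ord_recr /= mulrDl.
have z1 : 1 <= 1 + normc z by rewrite lerDl normc_ge0.
apply: lerD; [apply: le_trans (IH z) _|apply: le_trans (H z) _].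
  by rewrite ler_wpM2l // ler_weXn2l // leq_addr.
by rewrite ler_wpM2l // ler_weXn2l // leq_addl.
Qed.

Variables (D : set C) (G : C -> C).
Hypotheses (Do : open D) (Gc : forall z, D z -> {for z, continuous G}).

Local Notation ev P z := (P.[(G z)%:P].[z]).

Definition vanishes_near P a := evt a [set z | ev P z = 0].

(** Minimality is over relations near any point of [D], not only near [a], so that degrees can be
    compared after moving to another point. *)
Definition minimal_relation P := [/\ P != 0,
  exists2 a, D a & vanishes_near P a &
  forall Q b, D b -> Q != 0 -> vanishes_near Q b -> (size P <= size Q)%N].

Lemma ev_continuous P z : D z -> {for z, continuous (fun w : C => ev P w : C)}.
Proof. by move=> Dz; apply: (@smooth_poly2 _ 0); exact: Gc. Qed.

Lemma minimal_relation_size P : minimal_relation P -> (1 < size P)%N.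
Proof.
move=> [P0 [a Da Pa] _]; rewrite ltnNge; apply/negP => /size1_polyC PE.
move/negP: P0; apply; rewrite PE polyC_eq0; apply/eqP.
apply: (@poly_vanish_evt _ _ a); move: Pa; apply: evtS => z /=.
by rewrite {1}PE hornerC.
Qed.

(** This is irreducibility in t. Up to a factor in K[z], P = F d with d the gcd. [F] is too small to
    be a relation near [b], so it is nonzero at some nearby z; then [d] vanishes around z, and
    minimality makes [d] as large as [P]. *)
Lemma minimal_relation_dvd P Q b : minimal_relation P -> D b ->
  vanishes_near P b -> (1 < size (gcdp P Q))%N -> P %| Q.
Proof.
move=> [P0 _ Pmin] Db Pb; set d := gcdp P Q => sd.
have dP : d %| P by exact: dvdp_gcdl.
have := dP; rewrite Pdiv.WeakIdomain.dvdp_eq.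
set c := _ ^+ _; set F := P %/ d => /eqP PE.
have d0 : d != 0 by rewrite -size_poly_gt0 (ltn_trans _ sd).
have c0 : c != 0 by rewrite expf_neq0 // lead_coef_eq0.
have F0 : F != 0.
  apply: contraNneq P0 => F0; move/eqP: PE; rewrite F0 mul0r scale_poly_eq0.
  by rewrite (negbTE c0).
have Fd z : ev P z = 0 -> ev F z * ev d z = 0.
  by move=> Pz; rewrite -!hornerM -PE hornerZ hornerM Pz mulr0.
suff : (size P <= size d)%N.
  move=> Pd; have : size d == size P by rewrite eqn_leq Pd dvdp_leq.
  rewrite dvdp_size_eqp // => dEP; rewrite -(eqp_dvdl _ dEP); exact: dvdp_gcdr.
have /open_evt Do' := Do.
have [vF|] := pselect (vanishes_near F b).
  have := Pmin F b Db F0 vF; rewrite /F size_divp //.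
  have : (0 < size P)%N by rewrite size_poly_gt0.
  move: sd; case: (size d) => // -[|n] //= _ sP.
  by case: (size P) sP => // m _; rewrite subSS ltnNge leq_subr.
move=> nF.
have [r0 r00 hr] := evtI Pb (Do' b Db).
have [z [zr Fz]] : exists z, normc (z - b) < r0 /\ ev F z != 0.
  apply: contra_notP nF => nF; exists r0 => // z zr; apply/eqP/negP => /negP Fz.
  by apply: nF; exists z.
have [_ Dz] := hr z zr.
apply: (Pmin d z Dz d0).
have /open_evt /(_ z zr) Bz := disc_open (a:=b) (d:=r0).
have Fc := @ev_continuous F z Dz.
move: (evtI Bz (evt_neq0 Fc Fz)); apply: evtS => w [/hr[Pw Dw] Fw].
by have /eqP := Fd w Pw; rewrite mulf_eq0 => /orP[|/eqP //]; rewrite (negbTE Fw).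
Qed.

(** Bezout's identity in t over the field K(z) with denominators cleared: [c] plays the part of a
    resultant. *)
Lemma coprime_relation P Q : coprimep P Q -> exists2 c : {poly K}, c != 0 &
  forall z, ev P z = 0 -> ev Q z = 0 -> c.[z] = 0.
Proof.
move=> /Bezout_coprimepP[[u v] /eqpP[[c1 c2] /andP[/= c10 c20] H]].
exists c2 => // z Pz Qz; have /(congr1 (fun T => ev T z)) := H.
rewrite hornerZ hornerD !hornerM hornerD !hornerM Pz Qz !mulr0 addr0 mulr0.
by rewrite hornerZ hornerC mulr1 => <-.
Qed.

(** Induction on the degree of [Q]: if [P] and [Q] share a factor, then [P] divides [Q] and [Q] is
    replaced by the quotient; if they are coprime, connectedness off the roots of [c] concludes. *)
Lemma relation_propagates P Q U b : minimal_relation P -> open U ->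
  segment_closed U -> U `<=` D -> Q != 0 -> (forall z, U z -> ev Q z = 0) ->
  U b -> vanishes_near P b -> forall z, U z -> ev P z = 0.
Proof.
move=> Pm Uo Uc UD Q0 QU Ub Pb.
(* Weakened to the vanishing of the product, the hypothesis survives the division of [Q] by [P]. *)
have {QU} : forall z, U z -> ev P z * ev Q z = 0.
  by move=> z Uz; rewrite QU // mulr0.
have [n] := ubnP (size Q); elim: n => // n IH in Q Q0 *; rewrite ltnS => sQ PQ.
have [cop|ncop] := boolP (coprimep P Q); last first.
  have PQd : P %| Q.
    apply: (minimal_relation_dvd Pm (UD b Ub) Pb).
    rewrite ltn_neqAle eq_sym -coprimep_def ncop /= size_poly_gt0 gcdp_eq0.
    by rewrite (negbTE Q0) andbF.
  have P0 : P != 0 by case: Pm.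
  move: (PQd); rewrite Pdiv.WeakIdomain.dvdp_eq; set c := _ ^+ _ => /eqP QE.
  have Q'0 : Q %/ P != 0.
    rewrite divpN0 // dvdp_leq //.
  apply: (IH (Q %/ P)) => //.
    apply: leq_trans sQ; rewrite size_divp // ltn_subrL.
    by rewrite -subn1 subn_gt0 minimal_relation_size // size_poly_gt0.
  move=> z Uz; have cQ : c.[z] * ev Q z = ev (Q %/ P) z * ev P z.
    by rewrite -!hornerM -QE hornerZ hornerM.
  have /(congr1 ( *%R c.[z])) /eqP := PQ z Uz.
  rewrite mulr0 mulrCA cQ !mulf_eq0 orbCA orbb orbC => h.
  by apply/eqP; rewrite mulf_eq0.
have [c c0 cP] := coprime_relation cop.
have Uo' := (open_evt U).1 Uo.
have clf := locally_finite_roots c0.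
(* The product vanishes and there is no common zero off the roots of [c], so exactly one of [P] and
   [Q] vanishes at each remaining point. Near [b] it is [P]. *)
pose A : set C := [set z | U z /\ ev Q z != 0].
pose B : set C := [set z | U z /\ ev P z != 0].
have evo (T : {poly {poly K}}) : open [set z | U z /\ ev T z != 0].
  apply/open_evt => z [Uz Tz]; apply: evtI; first exact: Uo'.
  by apply: evt_neq0 => //; apply: ev_continuous; exact: UD.
have [a ca [Ua Pa]] := locally_finite_other clf (evtI (Uo' b Ub) Pb).
have offc z : U z -> c.[z] != 0 -> ev P z = 0.
  move=> Uz cz; suff [_ Qz] : A z.
    by have /eqP := PQ z Uz; rewrite mulf_eq0 (negbTE Qz) orbF => /eqP.
  apply: (@connected_off R _ U A B clf Uo Uc (evo Q) (evo P) _ _ a z) => //.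
  - move=> w Uw cw; have [Qw|Qw] := eqVneq (ev Q w) 0; last by left.
    by right; split => //; apply/negP => /eqP Pw; apply: cw; exact: cP.
  - move=> w Uw _ [[_ Qw] [_ Pw]]; have /eqP := PQ w Uw.
    by rewrite mulf_eq0 (negbTE Qw) (negbTE Pw).
  - by split => //; apply/negP => /eqP Qa; apply: ca; exact: cP.
  - exact/eqP.
move=> z Uz; apply: (@vanish_dense R _ (fun w => ev P w) z clf).
  by apply: ev_continuous; exact: UD.
by move: (Uo' z Uz); apply: evtS => w Uw /eqP cw; exact: offc.
Qed.

Hypothesis Dlf : locally_finite (~` D).
Hypothesis Dnash : forall a, D a ->
  exists2 Q, Q != 0 & vanishes_near Q a.

Lemma exists_minimal_relation : exists P, minimal_relation P.
Proof.
pose S n := `[< exists Q, [/\ size Q = n, Q != 0 &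
  exists2 b, D b & vanishes_near Q b] >].
have [a /contrapT Da _] : exists2 a, ~ (~` D) a & setT a.
  by apply: (locally_finite_other (a := 0) Dlf); exact: evtW.
have exS : exists n, S n.
  have [Q Q0 Qa] := Dnash Da.
  by exists (size Q); apply/asboolP; exists Q; split => //; exists a.
have [n /asboolP[P [Pn P0 Pb]] nmin] := ex_minnP exS.
exists P; split => // Q b Db Q0 Qb; rewrite Pn; apply: nmin.
by apply/asboolP; exists Q; split => //; exists b.
Qed.

(** On a small disc some relation [Q] holds, so [P] holds on the whole disc as soon as it holds near
    one of its points. Thus holding nearby and failing nearby are both open conditions on the
    connected set [D]. *)
Lemma minimal_relation_global P : minimal_relation P ->
  forall z, D z -> ev P z = 0.
Proof.
move=> Pm; have [P0 [a Da Pa] _] := Pm.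
have Do' := (open_evt D).1 Do.
pose A : set C := [set z | D z /\ vanishes_near P z].
pose B : set C := [set z | D z /\ ~ vanishes_near P z].
have local b : D b -> exists d : R, [/\ 0 < d, disc b d `<=` D &
    forall c, disc b d c -> vanishes_near P c ->
      forall z, disc b d z -> ev P z = 0].
  move=> Db; have [Q Q0 Qb] := Dnash Db.
  have [d d0 dP] := evtI Qb (Do' b Db).
  have dD : disc b d `<=` D by move=> z /dP[].
  exists d; split => // c dc Pc z dz.
  apply: (relation_propagates Pm _ _ _ Q0 _ dc Pc dz) => //.
  - exact: disc_open.
  - exact: disc_convex.
  - by move=> w /dP[].
have Ao : open A.
  apply/open_evt => z [Dz Pz].
  have [d [d0 dD dP]] := local z Dz.
  exists d => // w wd; split; first exact: dD.
  have /open_evt /(_ w wd) := disc_open (a:=z) (d:=d); apply: evtS => u du.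
  by apply: (dP z) => //; rewrite /disc /= subrr normc0.
have Bo : open B.
  apply/open_evt => z [Dz Pz].
  have [d [d0 dD dP]] := local z Dz.
  exists d => // w wd; split; first exact: dD.
  move=> Pw; apply: Pz; exists d => // u du; exact: (dP w).
move=> z Dz.
suff [_ /evt_point] : A z by [].
apply: (@connected_off R _ setT A B Dlf openT _ Ao Bo _ _ a z) => //.
- by move=> w _ /contrapT Dw; have [?|?] := pselect (vanishes_near P w); [left|right].
- by move=> w _ _ [[_ ?] [_ ?]].
Qed.

Theorem nash_rational : exists p q : {poly K},
  forall z, D z -> q.[z] != 0 /\ q.[z] * G z = p.[z].
Proof.
have [P Pm] := exists_minimal_relation.
have PD := minimal_relation_global Pm.
have [P0 [a Da Pa] _] := Pm; have sP := minimal_relation_size Pm.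
have Do' := (open_evt D).1 Do.
(* A common factor would make [P] divide its derivative, which is nonzero in characteristic 0 and of
   smaller degree. *)
have cop : coprimep P P^`().
  rewrite coprimep_def eqn_leq andbC size_poly_gt0 gcdp_eq0 negb_and P0 /=.
  rewrite leqNgt; apply/negP => /(minimal_relation_dvd Pm Da Pa) PP'.
  have P'0 : P^`() != 0.
    have [m mE] : exists m, size P = m.+2.
      by case: (size P) sP => [|[|m]] // _; exists m.
    have lE : P`_m.+1 = lead_coef P by rewrite lead_coefE mE.
    apply/eqP => /(congr1 (fun T : {poly {poly K}} => T`_m)).
    rewrite coef0 coef_deriv lE.
    move=> /(congr1 (fun T : {poly K} => T`_(size (lead_coef P)).-1)).
    rewrite coef0 coefMn -lead_coefE => /eqP.
    by rewrite mulrn_eq0 !lead_coef_eq0 (negbTE P0).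
  have := dvdp_leq P'0 PP'; rewrite leqNgt lt_size_deriv //.
have [c c0 cP] := coprime_relation cop.
pose n := (size P).-1; have nP : size P = n.+1 by rewrite prednK // (ltn_trans _ sP).
pose l : {poly K} := P`_n.
have l0 : l != 0 by rewrite /l -lead_coefE lead_coef_eq0.
(* Where the t-derivative of [P] vanishes along [G], so does [c]; off [E] the root is therefore
   simple and [G] has expansions. *)
pose E : set C := ~` D `|` [set z | c.[z] = 0].
have Elf : locally_finite E by apply: locally_finiteU => //; exact: locally_finite_roots.
(* The default value 0 on [E] makes the growth bound hold on the whole plane. *)
pose g (z : C) : C := if `[< E z >] then 0 else l.[z] * G z.
have [B [N [B0 BN]]] := poly_sum_growth n.+1 (fun j => P`_j).
have gB z : normc (g z) <= B * (1 + normc z) ^+ N.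
  rewrite /g; case: asboolP => Ez.
    by rewrite normc0 mulr_ge0 // exprn_ge0 // addr_ge0 ?normc_ge0.
  apply: le_trans (BN z).
  apply: (@lead_term_bound n (fun j => (P`_j).[z]) (G z)); first by rewrite -ltnS -nP.
  have : D z by apply: contrapT => Dz; apply: Ez; left.
  move=> /PD Pz; rewrite -[RHS]Pz (horner_coef P) nP horner_sum; apply: eq_bigr => j _.
  by rewrite hornerM -rmorphXn hornerC.
have [p pE] : exists p : {poly K}, forall z, ~ E z -> g z = p.[z].
  apply: (@liouville R E g B N.+1 Elf).
    move=> z Ez; have /not_orP[/contrapT Dz cz] := Ez.
    apply: (@smooth_near _ _ (fun w => l.[w] * G w)).
      move: (locally_finite_evtC Elf Ez); apply: evtS => w Ew /=.
      by rewrite /g; case: asboolP.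
    apply: smoothM; first exact: smooth_poly.
    apply: (@algebraic_smooth R 2 P); first exact: Gc.
      by move: (Do' z Dz); apply: evtS => w; exact: PD.
    by apply/negP => /eqP P'z; apply: cz; apply: cP => //; exact: PD.
  move=> z; rewrite exprSr mulrA ler_wpM2r // addr_ge0 ?normc_ge0 //.
(* Continuity of [G] extends the identity to the zeros of [c] in [D]. *)
have lG z : D z -> l.[z] * G z = p.[z].
  move=> Dz; apply/eqP; rewrite -subr_eq0 -mulN1r; apply/eqP.
  apply: (@vanish_dense R E (fun w => l.[w] * G w + (-1) * p.[w]) z Elf) => [|].
    have cl := @smooth_poly R 0 l z; have cp := @smooth_poly R 0 p z.
    have c1 : {for z, continuous (fun _ : C => -1 : C)} by exact: cst_continuous.
    exact: (continuousD (continuousM cl (Gc Dz)) (continuousM c1 cp)).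
  move: (Do' z Dz); apply: evtS => w Dw Ew.
  by rewrite -pE // /g; case: asboolP => // _; rewrite mulN1r subrr.
pose d := gcdp p l; pose p' := p %/ d; pose q := l %/ d.
have pd : p = p' * d by rewrite divpK // dvdp_gcdl.
have ld : l = q * d by rewrite divpK // dvdp_gcdr.
have d0 : d != 0 by rewrite gcdp_eq0 negb_and l0 orbT.
have qG z : D z -> q.[z] * G z = p'.[z].
  move=> Dz; apply/eqP; rewrite -subr_eq0 -mulN1r; apply/eqP.
  apply: (@vanish_dense R _ (fun w => q.[w] * G w + (-1) * p'.[w]) z (locally_finite_roots d0)) => [|].
    have cl := @smooth_poly R 0 q z; have cp := @smooth_poly R 0 p' z.
    have c1 : {for z, continuous (fun _ : C => -1 : C)} by exact: cst_continuous.
    exact: (continuousD (continuousM cl (Gc Dz)) (continuousM c1 cp)).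
  move: (Do' z Dz); apply: evtS => w Dw /eqP dw.
  apply: (mulfI dw); rewrite mulr0 mulrDr mulN1r mulrN mulrA.
  by rewrite ![d.[w] * _]mulrC -!hornerM -pd -ld lG // subrr.
exists p', q => z Dz; split; last exact: qG.
(* A zero of [q] in [D] would, by [qG], also be a zero of the coprime numerator. *)
apply/negP => qz.
have : coprimep p' q by apply: coprimep_div_gcd; rewrite l0 orbT.
rewrite coprimep_sym => /coprimep_root/(_ qz).
by rewrite -qG // (eqP qz) mul0r eqxx.
Qed.

End Nash.

(** * Quaternions and octonions *)

Section SliceAlgebra.
Variable R : realType.

(** The axioms that every Cayley-Dickson doubling preserves. Associativity is not among them; its
    substitute, left alternativity, is checked on coordinates. *)
Record star_bilinear (A : starAlg R) : Prop := StarBilinear {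
  smulDl : forall x y z : A, smul (x + y) z = smul x z + smul y z;
  smulDr : forall x y z : A, smul x (y + z) = smul x y + smul x z;
  smulZl : forall (a : R) (x y : A), smul (a *: x) y = a *: smul x y;
  smulZr : forall (a : R) (x y : A), smul x (a *: y) = a *: smul x y;
  smul1l : forall x : A, smul sone x = x;
  smul1r : forall x : A, smul x sone = x;
  sconjD : forall x y : A, sconj (x + y) = sconj x + sconj y;
  sconjZ : forall (a : R) (x : A), sconj (a *: x) = a *: sconj x;
  sconj1 : sconj sone = sone :> A }.

Lemma real_star_bilinear : star_bilinear (real_alg R).
Proof.
split => //=.
- by move=> x y z; rewrite mulrDl.
- by move=> x y z; rewrite mulrDr.
- by move=> a x y; rewrite -[LHS]mulrA.
- by move=> a x y; rewrite [LHS]mulrCA.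
- by move=> x; rewrite mul1r.
- by move=> x; rewrite mulr1.
Qed.

Lemma cayley_dickson_star_bilinear (A : starAlg R) :
  star_bilinear A -> star_bilinear (cayley_dickson A).
Proof.
move=> [Dl Dr Zl Zr l1 r1 cD cZ c1].
have m0 (x : A) : smul x 0 = 0 by have := Zr 0 x 0; rewrite !scale0r.
have m0' (x : A) : smul 0 x = 0 by have := Zl 0 0 x; rewrite !scale0r.
have cc0 : sconj 0 = 0 :> A by have := cZ 0 0; rewrite !scale0r.
split => /=.
- move=> [x x'] [y y'] [z z'] /=; congr pair => /=.
    by rewrite Dl Dr opprD addrACA.
  by rewrite Dr Dl addrACA.
- move=> [x x'] [y y'] [z z'] /=; congr pair => /=.
    by rewrite Dr cD Dl opprD addrACA.
  by rewrite Dl cD Dr addrACA.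
- move=> a [x x'] [y y'] /=; congr pair => /=.
    by rewrite Zl Zr -scalerBr.
  by rewrite Zr Zl -scalerDr.
- move=> a [x x'] [y y'] /=; congr pair => /=.
    by rewrite Zr cZ Zl -scalerBr.
  by rewrite Zl cZ Zr -scalerDr.
- move=> [x x'] /=; congr pair.
    by rewrite l1 m0 subr0.
  by rewrite r1 m0' addr0.
- move=> [x x'] /=; congr pair.
    by rewrite r1 cc0 m0' subr0.
  by rewrite m0' c1 r1 add0r.
- by move=> [x x'] [y y'] /=; congr pair => /=; rewrite ?cD ?opprD.
- by move=> a [x x'] /=; congr pair => /=; rewrite ?cZ ?scalerN.
- by rewrite c1 oppr0.
Qed.

Lemma HOalg_star_bilinear k : star_bilinear (HOalg R k).
Proof.
by case: k; do ?[exact: real_star_bilinear|apply: cayley_dickson_star_bilinear].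
Qed.

(** This is what makes left multiplication by an imaginary unit a complex structure on the algebra,
    even for octonions. *)
Lemma HOalg_left_alternative k (x y : HOalg R k) :
  smul x (smul x y) = smul (smul x x) y.
Proof.
case: k x y => /=.
  move=> [[a0 a1] [a2 a3]] [[b0 b1] [b2 b3]] /=.
  by congr (_, _); congr (_, _) => /=; ring.
move=> [[[a0 a1] [a2 a3]] [[a4 a5] [a6 a7]]] [[[b0 b1] [b2 b3]] [[b4 b5] [b6 b7]]] /=.
by congr (_, _); congr (_, _); congr (_, _) => /=; ring.
Qed.

Definition HOre k : HOalg R k -> R :=
  match k with HH => fun x => x.1.1 | OO => fun x => x.1.1.1 end.

Lemma HOreZ k (a : R) (x : HOalg R k) : HOre (a *: x) = a * HOre x.
Proof. by case: k x => x; rewrite /HOre /=. Qed.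

Lemma HOreD k (x y : HOalg R k) : HOre (x + y) = HOre x + HOre y.
Proof. by case: k x y => x y; rewrite /HOre /=. Qed.

Lemma HOre1 k : HOre (sone : HOalg R k) = 1.
Proof. by case: k; rewrite /HOre /=. Qed.

Lemma HOalg_quadratic k (x : HOalg R k) : exists n : R,
  smul x x = (2%:R * HOre x) *: x - n *: sone.
Proof.
case: k x => /=.
  move=> [[a0 a1] [a2 a3]]; exists (a0 ^+ 2 + a1 ^+ 2 + a2 ^+ 2 + a3 ^+ 2).
  by congr (_, _); congr (_, _) => /=; rewrite /GRing.scale /=; ring.
move=> [[[a0 a1] [a2 a3]] [[a4 a5] [a6 a7]]].
exists (a0 ^+ 2 + a1 ^+ 2 + a2 ^+ 2 + a3 ^+ 2 +
        a4 ^+ 2 + a5 ^+ 2 + a6 ^+ 2 + a7 ^+ 2).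
by congr (_, _); congr (_, _); congr (_, _) => /=; rewrite /GRing.scale /=; ring.
Qed.

(** Otherwise the quadratic equation of [J] makes it a real multiple of [sone], and a real square
    cannot be -1. *)
Lemma SA_HOre k (J : HOalg R k) : SA J -> HOre J = 0.
Proof.
rewrite /SA /= => JJ; have [n] := HOalg_quadratic J; rewrite JJ => H.
apply/eqP/negP => /negP r0.
have r20 : 2%:R * HOre J != 0 by rewrite mulf_neq0 // pnatr_eq0.
have JE : J = ((n - 1) / (2%:R * HOre J)) *: sone.
  apply: (scalerI r20); rewrite scalerA.
  rewrite [X in _ = X *: _](_ : _ = n - 1); last by rewrite mulrC divfK.
  by rewrite scalerBl scale1r H addrC subrK.
have [_ _ Zl Zr l1 _ _ _ _] := HOalg_star_bilinear k.
move: JJ; rewrite {1 2}JE Zl l1 scalerA => /(congr1 (@HOre k)).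
rewrite HOreZ -[X in _ = HOre X]scaleN1r HOreZ HOre1 !mulr1.
set t := _ / _ => tt; have := sqr_ge0 t; rewrite expr2 tt lerNr oppr0.
by rewrite ler10.
Qed.

Lemma SA_nonempty k : exists J : HOalg R k, SA J.
Proof.
case: k.
  exists ((0, 1), (0, 0)); rewrite /SA /=.
  by congr (_, _); congr (_, _) => /=; ring.
exists (((0, 1), (0, 0)), ((0, 0), (0, 0))); rewrite /SA /=.
by congr (_, _); congr (_, _); congr (_, _) => /=; ring.
Qed.

End SliceAlgebra.

(** * Stem and slice functions *)

Section SliceFunctions.
Variables (R : realType) (k : HO).
Local Notation C := (R[i]^o).
Local Notation K := R[i].
Local Notation Re := complex.Re.
Local Notation Im := complex.Im.
Local Notation A := (HOalg R k).
Local Notation AC := (A * A)%type.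
Local Notation "x *q y" := (smul x y) (at level 40, left associativity).
Implicit Types (z w c : C) (I J : A) (p : AC) (D : set C) (F : C -> AC).

Let Dl := smulDl (HOalg_star_bilinear R k).
Let Dr := smulDr (HOalg_star_bilinear R k).
Let Zl := smulZl (HOalg_star_bilinear R k).
Let Zr := smulZr (HOalg_star_bilinear R k).
Let one_l := smul1l (HOalg_star_bilinear R k).
Let one_r := smul1r (HOalg_star_bilinear R k).

Lemma smulNr (x y : A) : x *q (- y) = - (x *q y).
Proof. by rewrite -scaleN1r Zr scaleN1r. Qed.

Lemma smulNl (x y : A) : (- x) *q y = - (x *q y).
Proof. by rewrite -scaleN1r Zl scaleN1r. Qed.

Lemma smul0r (x : A) : x *q 0 = 0.
Proof. by rewrite -[X in _ *q X](scale0r (0 : A)) Zr scale0r. Qed.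

Lemma smul_sumr (x : A) n (u : 'I_n -> A) :
  x *q (\sum_(j < n) u j) = \sum_(j < n) x *q u j.
Proof.
elim/big_rec2: _ => [|j y1 y2 _ <-]; first exact: smul0r.
by rewrite Dr.
Qed.

Lemma double_inj (x y : A) : x + x = y + y -> x = y.
Proof.
move=> E; have n2 : (2%:R : R) != 0 by rewrite pnatr_eq0.
by apply: (scalerI n2); rewrite !scaler_nat !mulr2n.
Qed.

Lemma SA_smulK I x : SA I -> I *q (I *q x) = - x.
Proof. by rewrite /SA /= => II; rewrite HOalg_left_alternative II smulNl one_l. Qed.

Lemma SA_opp I : SA I -> SA (- I).
Proof. by rewrite /SA /= => II; rewrite smulNl smulNr opprK. Qed.

Lemma sone_neq0 : (sone : A) != 0.
Proof.
apply/eqP => /(congr1 (@HOre R k)); rewrite HOre1 -(scale0r (0 : A)) HOreZ mul0r.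
by move/eqP; rewrite oner_eq0.
Qed.

Lemma spt_smul z I x : spt z I *q x = Re z *: x + Im z *: (I *q x).
Proof. by rewrite /spt Dl !Zl one_l. Qed.

(** Associativity does hold for two left factors from the same slice, so A is a vector space over
    C_I. *)
Lemma spt_smulA z w I x : SA I -> spt z I *q (spt w I *q x) = spt (z * w) I *q x.
Proof.
move=> SI; rewrite !spt_smul Dr !Zr SA_smulK // cReM cImM.
rewrite !scalerDr !scalerA scalerBl scalerDl scalerN.
rewrite [Im z * Re w]mulrC -!addrA; congr (_ + _).
rewrite addrC -!addrA [LHS]addrC -!addrA [RHS]addrC -!addrA.
by rewrite ![- _ + _]addrC !addrA; congr (_ + _); rewrite addrC.
Qed.

Lemma spt_sone z I : spt z I *q sone = spt z I.
Proof. by rewrite one_r. Qed.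

Lemma spt_spt z w I : SA I -> spt z I *q spt w I = spt (z * w) I.
Proof. by move=> SI; rewrite -[spt w I]spt_sone spt_smulA // spt_sone. Qed.

Lemma HOre_spt z I : SA I -> HOre (spt z I) = Re z.
Proof. by move=> SI; rewrite HOreD !HOreZ HOre1 SA_HOre // mulr0 addr0 mulr1. Qed.

Lemma spt_inj z w I J : SA I -> SA J -> spt z I = spt w J ->
  (z = w /\ (I = J \/ Im z = 0)) \/ (w = conjc z /\ J = - I).
Proof.
move=> SI SJ E.
have ER : Re z = Re w by rewrite -(HOre_spt z SI) E HOre_spt.
have EI : Im z *: I = Im w *: J.
  by move: E; rewrite /spt ER => /addrI.
have E2 : Im w ^+ 2 = Im z ^+ 2.
  have : (Im z *: I) *q (Im z *: I) = (Im w *: J) *q (Im w *: J) by rewrite EI.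
  rewrite !Zl !Zr !scalerA (SI : I *q I = _) (SJ : J *q J = _) => /eqP.
  rewrite -subr_eq0 -scalerBl scaler_eq0 oppr_eq0 (negbTE sone_neq0) orbF.
  by rewrite subr_eq0 -!expr2 => /eqP.
have [z0|z0] := eqVneq (Im z) 0.
  left; split; last by right.
  move: E2; rewrite z0 expr0n => /eqP; rewrite sqrf_eq0 => /eqP w0.
  by apply/eqP; rewrite eq_complex ER z0 w0 !eqxx.
have /eqP := E2; rewrite eqf_sqr => /orP[]/eqP EIm.
  left; split; first by apply/eqP; rewrite eq_complex ER EIm !eqxx.
  by left; apply: (scalerI z0); rewrite EI EIm.
right; split.
  by move: ER EIm; case: (z) (w) => [x y] [x' y'] /= -> ->.
by apply: (scalerI z0); rewrite scalerN EI EIm scaleNr opprK.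
Qed.

(** Well-definedness of the induced slice function: conjugating z changes the sign of both the unit
    and the second component, and at real z the second component is zero. *)
Lemma stem_value D F z w I J : stem D F -> D z -> SA I -> SA J ->
  spt w J = spt z I -> D w /\
  (F w).1 + J *q (F w).2 = (F z).1 + I *q (F z).2.
Proof.
move=> [Dc Fc] Dz SI SJ /esym /(spt_inj SI SJ)[[<- [->|z0]]|[-> ->]].
- by [].
- split => //; suff -> : (F z).2 = 0 by rewrite !smul0r.
  have zc : conjc z = z by move: z0; case: (z) => x y /= ->; rewrite oppr0.
  have := Fc z Dz; rewrite zc /acbar => /(congr1 snd) /= F2.
  by apply: double_inj; rewrite {1}F2 addNr addr0.
- by split; [exact: Dc|rewrite Fc //= smulNl smulNr opprK].
Qed.

Lemma slice_of_spt D F z I : stem D F -> D z -> SA I ->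
  slice_of F (spt z I) = (F z).1 + I *q (F z).2.
Proof.
move=> FS Dz SI; rewrite /slice_of; case: xgetP => [y -> [w [J [SJ zw ->]]]|].
  by have [] := stem_value FS Dz SI SJ (esym zw).
by move=> /(_ ((F z).1 + I *q (F z).2)) []; exists z, I.
Qed.

(** The values at [I] and [- I] determine both components, so the stem function picked by choice
    agrees with any explicit one. *)
Lemma stem_of_eq (Omega : set A) (f : A -> A) F :
  stem (profile Omega) F -> induces (profile Omega) F f ->
  forall z, profile Omega z -> stem_of Omega f z = F z.
Proof.
move=> FS Ff z Dz; rewrite /stem_of; case: xgetP => [G _ [GS Gf]|]; last first.
  by move=> /(_ F) [].
have [I SI] := SA_nonempty R k.
have e1 := Gf z I Dz SI; have e2 := Gf z _ Dz (SA_opp SI).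
rewrite (Ff z I Dz SI) in e1; rewrite (Ff z _ Dz (SA_opp SI)) !smulNl in e2.
have E1 : (F z).1 = (G z).1.
  apply: double_inj; have := congr2 +%R e1 e2.
  by rewrite !addrA [(F z).1 + _ + _]addrAC [(G z).1 + _ + _]addrAC !addrK.
have E2 : (F z).2 = (G z).2.
  move: e1; rewrite E1 => /addrI /(congr1 (smul I)).
  by rewrite !SA_smulK // => /oppr_inj.
by rewrite [LHS]surjective_pairing [RHS]surjective_pairing E1 E2.
Qed.

Lemma fst_sum n (u : 'I_n -> AC) : (\sum_(j < n) u j).1 = \sum_(j < n) (u j).1.
Proof. by elim/big_rec2: _ => // j y1 y2 _ <-. Qed.

Lemma snd_sum n (u : 'I_n -> AC) : (\sum_(j < n) u j).2 = \sum_(j < n) (u j).2.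
Proof. by elim/big_rec2: _ => // j y1 y2 _ <-. Qed.

(** Multiplication by the complex number Re c + iota Im c on the complexified algebra, where iota is
    central. *)
Definition cact c p : AC :=
  (Re c *: p.1 - Im c *: p.2, Re c *: p.2 + Im c *: p.1).

Lemma cactD c p p' : cact c (p + p') = cact c p + cact c p'.
Proof.
by congr (_, _); rewrite /= !scalerDr ?opprD addrACA.
Qed.

Lemma cact_sum c n (u : 'I_n -> AC) :
  cact c (\sum_(j < n) u j) = \sum_(j < n) cact c (u j).
Proof.
elim/big_rec2: _ => [|j y1 y2 _ <-]; last exact: cactD.
by congr (_, _); rewrite /= !scaler0 ?subr0 ?addr0.
Qed.

Lemma cactDl c c' p : cact (c + c') p = cact c p + cact c' p.
Proof.
by congr (_, _); rewrite /= cReD cImD !scalerDl ?opprD addrACA.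
Qed.

Lemma cact_suml n (u : 'I_n -> C) p :
  cact (\sum_(j < n) u j) p = \sum_(j < n) cact (u j) p.
Proof.
elim/big_rec2: _ => [|j y1 y2 _ <-]; last exact: cactDl.
by congr (_, _); rewrite /= !scale0r ?subr0 ?addr0.
Qed.

Lemma cactM c c' p : cact (c * c') p = cact c (cact c' p).
Proof.
case: p => x y; rewrite /cact /=; congr (_, _); rewrite cReM cImM.
  rewrite scalerBr !scalerDr !scalerA scalerBl scalerDl !opprD.
  by rewrite addrACA; congr (_ + _); rewrite addrC.
rewrite scalerBr !scalerDr !scalerA scalerBl scalerDl.
by rewrite addrACA; congr (_ + _); rewrite addrC.
Qed.

Lemma cact1 p : cact 1 p = p.
Proof. by case: p => x y; rewrite /cact /= !scale1r !scale0r subr0 addr0. Qed.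

Lemma acbar_cact c p : acbar (cact (conjc c) p) = cact c (acbar p).
Proof.
case: c p => [a b] [x y]; rewrite /cact /acbar /=; congr (_, _).
  by rewrite scaleNr opprK scalerN opprK.
by rewrite scaleNr opprD opprK scalerN.
Qed.

Lemma acbarD p p' : acbar (p + p') = acbar p + acbar p'.
Proof. by rewrite /acbar; congr (_, _) => /=; rewrite opprD. Qed.

Lemma acbar_sum n (u : 'I_n -> AC) :
  acbar (\sum_(j < n) u j) = \sum_(j < n) acbar (u j).
Proof.
elim/big_rec2: _ => [|j y1 y2 _ <-]; last exact: acbarD.
by rewrite /acbar /= oppr0.
Qed.

Definition cscalar c : AC := (Re c *: sone, Im c *: sone).

Lemma acmul_cscalar c p : acmul (cscalar c) p = cact c p.
Proof. by rewrite /acmul /cscalar /cact /= !Zl !one_l. Qed.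

Lemma spt_cscalar c I : (cscalar c).1 + I *q (cscalar c).2 = spt c I.
Proof. by rewrite /cscalar /= Zr one_r. Qed.

Lemma cscalar_stem D (r : C -> C) : conj_invariant D ->
  (forall z, D z -> r (conjc z) = conjc (r z)) -> stem D (fun z => cscalar (r z)).
Proof.
move=> Dc rc; split => // z Dz; rewrite rc // /cscalar /acbar.
by case: (r z) => x y /=; rewrite scaleNr.
Qed.

Lemma cact_stem D (r : C -> C) F :
  (forall z, D z -> r (conjc z) = conjc (r z)) -> stem D F ->
  stem D (fun z => cact (r z) (F z)).
Proof.
move=> rc [Dc Fc]; split => // z Dz; rewrite rc // Fc //.
by rewrite -[in RHS](conjcK (r z)) acbar_cact.
Qed.

(** Whatever inverse is chosen, multiplying on the left by [spt c^-1 I] within the slice identifies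
    it. *)
Lemma sinv_spt c I : SA I -> c != 0 -> sinv (spt c I) = spt c^-1 I.
Proof.
move=> SI c0; have s1 : spt 1 I = sone by rewrite /spt /= scale1r scale0r addr0.
rewrite /sinv; case: xgetP => [y _ [cy _]|].
  rewrite -[y]one_l -s1 -(mulVf c0) -spt_smulA // cy.
  exact: one_r.
by move=> /(_ (spt c^-1 I)) []; split; rewrite spt_spt // ?mulfV ?mulVf.
Qed.

Lemma spow_spt z I n : SA I -> spow (spt z I) n = spt (z ^+ n) I.
Proof.
move=> SI; elim: n => [|n IH].
  by rewrite /spow /= /spt /= scale1r scale0r addr0.
by rewrite /spow iterS -/(spow _ _) IH spt_spt // exprS.
Qed.

Definition poly_stem (a : seq A) z : AC :=
  \sum_(s < size a) cact (z ^+ s) (a`_s, 0).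

Lemma slice_poly_spt a z I : SA I ->
  slice_poly a (spt z I) = (poly_stem a z).1 + I *q (poly_stem a z).2.
Proof.
move=> SI; rewrite /slice_poly /poly_stem.
rewrite fst_sum snd_sum smul_sumr -big_split; apply: eq_bigr => s _ /=.
by rewrite spow_spt // spt_smul scaler0 subr0 scaler0 add0r Zr.
Qed.

Lemma conjcX z n : conjc (z ^+ n) = conjc z ^+ n.
Proof. exact: rmorphXn. Qed.

Lemma poly_stem_stem D a : conj_invariant D -> stem D (poly_stem a).
Proof.
move=> Dc; split => // z _; rewrite /poly_stem acbar_sum; apply: eq_bigr => s _.
rewrite -[in RHS](conjcK (z ^+ s)) acbar_cact conjcX.
by rewrite /acbar /= oppr0.
Qed.

Lemma poly_stem_induces D a : induces D (poly_stem a) (slice_poly a).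
Proof. by move=> z I _ SI; exact: slice_poly_spt. Qed.

(** Here the coefficients may lie anywhere in the complexified algebra, whereas those of [poly_stem]
    lie in A. *)
Definition poly_map (T : C -> AC) := exists n (u : nat -> AC),
  forall z, T z = \sum_(s < n) cact (z ^+ s) (u s).

Lemma poly_map_cact (q : {poly K}) p : poly_map (fun z => cact q.[z] p).
Proof.
exists (size q), (fun s => cact q`_s p) => z.
rewrite horner_coef cact_suml; apply: eq_bigr => s _.
by rewrite mulrC cactM.
Qed.

Lemma poly_map_widen n (u : nat -> AC) m : exists v : nat -> AC,
  forall z, \sum_(s < n) cact (z ^+ s) (u s) = \sum_(s < n + m) cact (z ^+ s) (v s).
Proof.
exists (fun s => if (s < n)%N then u s else 0) => z.
rewrite big_split_ord /= [X in _ = _ + X]big1 ?addr0.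
  by apply: eq_bigr => s _; rewrite ltn_ord.
move=> s _; rewrite ltnNge leq_addr /=.
by congr (_, _); rewrite /= !scaler0 ?subr0 ?addr0.
Qed.

Lemma poly_mapD S T : poly_map S -> poly_map T ->
  poly_map (fun z => S z + T z).
Proof.
move=> [n [u uS]] [m [v vT]].
have [u' uE] := poly_map_widen n u m; have [v' vE] := poly_map_widen m v n.
exists (n + m)%N, (fun s => u' s + v' s) => z.
rewrite uS vT uE vE addnC -big_split; apply: eq_bigr => s _.
by rewrite cactD.
Qed.

Lemma poly_map_sum n (S : 'I_n -> C -> AC) : (forall j, poly_map (S j)) ->
  poly_map (fun z => \sum_(j < n) S j z).
Proof.
elim: n S => [|n IH] S HS.
  by exists 0%N, (fun=> 0) => z; rewrite !big_ord0.
have [m [u uS]] := poly_mapD (IH (fun j => S (widen_ord (leqnSn n) j)) (fun j => HS _)) (HS ord_max).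
by exists m, u => z; rewrite -uS big_ord_recr.
Qed.

(* Averaging T with its conjugate makes the coefficients real, i.e. in A. *)
Lemma poly_map_stem D T F : poly_map T -> stem D F -> (forall z, D z -> T z = F z) ->
  exists a : seq A, forall z, D z -> poly_stem a z = F z.
Proof.
move=> [n [u uT]] [Dc Fc] TF; exists (mkseq (fun s => (u s).1) n) => z Dz.
rewrite /poly_stem size_mkseq.
have two p : (2%:R : R)^-1 *: (p + p) = p.
  by rewrite scalerDr -scalerDl (_ : _ + _ = 1) ?scale1r //; field.
rewrite -(two (F z)).
have {2}-> : F z = acbar (T (conjc z)).
  by rewrite TF ?Fc; [rewrite /acbar /= opprK; case: (F z)|exact: Dz|exact: Dc].
rewrite -(TF z) // !uT acbar_sum -big_split scaler_sumr; apply: eq_bigr => s _.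
rewrite nth_mkseq // -conjcX acbar_cact.
rewrite [X in _ *: X](_ : _ = cact (z ^+ s) (u s + acbar (u s))); last first.
  by rewrite cactD.
rewrite (_ : u s + acbar (u s) = ((u s).1, 0) + ((u s).1, 0)); last first.
  by congr (_, _) => /=; rewrite ?subrr ?addr0.
by rewrite cactD two.
Qed.

End SliceFunctions.

(** * Rationality of slice-Nash functions *)

Section RationalFamilies.
Variable R : realType.
Local Notation C := (R[i]^o).
Local Notation K := R[i].
Local Notation Re := complex.Re.
Local Notation Im := complex.Im.
Implicit Types (z w : C) (D E : set C).

(** Isolation is asked only up to conjugation because a sphere meets a slice in two conjugate
    points. Finitely many of the sets [U a] cover a compact square, and each contributes at most two
    points. *)
Lemma locally_finite_isolated E :
  (forall a : C, evt a [set z | E z -> z = a \/ z = conjc a]) -> locally_finite E.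
Proof.
move=> Ea r; pose U (a : C) := [set z | evt z [set w | E w -> w = a \/ w = conjc a]].
have := @square_compact R r; rewrite compact_cover => /(_ C setT U)[||s _ sE].
- move=> a _; apply/open_evt => z [d d0 dP]; exists d => // w wd.
  by have /open_evt/(_ w wd) := @disc_open R z d; apply: evtS => v /dP.
- by move=> a _; exists a => //; exact: Ea.
exists (finmap.enum_fset s ++ map conjc (finmap.enum_fset s)) => z Ez zr.
have [a /= sa /evt_point /(_ Ez) za] := sE z (square_normc zr).
rewrite mem_cat; case: za => ->; first by rewrite sa.
by rewrite map_f ?orbT.
Qed.

Lemma complex_nash_rational D (G : C -> C) : open D -> locally_finite (~` D) ->
  complex_nash D G -> exists p q : {poly K},
  forall z, D z -> q.[z] != 0 /\ q.[z] * G z = p.[z].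
Proof.
move=> Do Dlf Gn; apply: nash_rational => // [z Dz|a Da].
  have [U [_ Uz _ Ud _]] := Gn z Dz.
  exact/differentiable_continuous/derivable1_diffP/Ud.
have [U [Uo Ua _ _ [P P0 PU]]] := Gn a Da.
by exists P => //; move: ((open_evt U).1 Uo a Ua); apply: evtS => z /PU.
Qed.

Lemma common_denominator D (T : finType) (G : T -> C -> C) : open D ->
  conj_invariant D -> locally_finite (~` D) -> (forall t, complex_nash D (G t)) ->
  exists (r : {poly K}) (p : T -> {poly K}),
    (forall z, r.[conjc z] = conjc r.[z]) /\
    forall z, D z -> r.[z] != 0 /\ forall t, r.[z] * G t z = (p t).[z].
Proof.
move=> Do Dc Dlf Gn.
have [pq pqE] := fin_all_exists (fun t => complex_nash_rational Do Dlf (Gn t)).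
have [q qE] := fin_all_exists pqE.
pose Q := \prod_t q t.
have Q0 z : D z -> Q.[z] != 0.
  move=> Dz; rewrite /Q horner_prod; apply/prodf_neq0 => t _.
  by have [] := qE t z Dz.
(* The conjugate of Q at the conjugate point: it is nonzero on [D] because [D] is
   conjugation-invariant. *)
pose Qc := map_poly (@conjc R) Q.
have Qcz z : Qc.[conjc z] = conjc Q.[z] by exact: horner_map.
have Qcz' z : Qc.[z] = conjc Q.[conjc z] by rewrite -Qcz conjcK.
exists (Q * Qc), (fun t => pq t * (\prod_(s | s != t) q s) * Qc); split.
  by move=> z; rewrite !hornerM Qcz Qcz' rmorphM /= conjcK mulrC.
move=> z Dz; split.
  by rewrite hornerM mulf_neq0 ?Q0 // Qcz' conjc_eq0 Q0 //; exact: Dc.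
move=> t; have [_ qt] := qE t z Dz.
rewrite /Q (bigD1 t) //= !hornerM -qt; ring.
Qed.

Lemma real_coefs (r : {poly K}) : (forall z, r.[conjc z] = conjc r.[z]) ->
  forall i, r`_i = (Re r`_i)%:C.
Proof.
move=> rc i.
have rE : map_poly (@conjc R) r = r.
  apply/eqP; rewrite -subr_eq0; apply/eqP.
  apply: (@poly_vanish_evt R _ 0); apply: evtW => z /=.
  by rewrite hornerD hornerN -[z in X in X - _]conjcK horner_map /= -rc conjcK subrr.
have : r`_i = conjc r`_i by rewrite -[in LHS]rE coef_map.
case: (r`_i) => x y /= [] /eqP; rewrite -subr_eq0 opprK -mulr2n mulrn_eq0 /=.
by move=> /eqP ->.
Qed.

End RationalFamilies.

(** * Singular sets seen in one slice *)

Section Singularities.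
Variables (R : realType) (k : HO).
Local Notation C := (R[i]^o).
Local Notation A := (HOalg R k).
Local Notation Re := complex.Re.
Local Notation Im := complex.Im.

Lemma spt_continuous (J : A) : continuous (fun z : C => spt z J).
Proof.
move=> a; have cR := @continuous_Re R a; have cI := @continuous_Im R a.
have c1 : {for a, continuous (fun _ : C => sone : A)} by exact: cst_continuous.
have cJ : {for a, continuous (fun _ : C => J)} by exact: cst_continuous.
exact: (continuousD (continuousZ cR c1) (continuousZ cI cJ)).
Qed.

Lemma circularizationP (D : set C) z (J : A) : conj_invariant D -> SA J ->
  circularization D (spt z J) <-> D z.
Proof.
move=> Dc SJ; split; last by move=> Dz; exists z, J.
move=> [w [I [Dw SI /(spt_inj SJ SI)[[-> //]|[wE _]]]]].
by rewrite -[z]conjcK -wE; exact: Dc.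
Qed.

(** Fix one slice. The open set isolating the sphere through a singular point meets the singular set
    in that sphere alone, whose trace on the slice is [a] and its conjugate. *)
Lemma singularities_locally_finite (Omega0 : set A) (D : set C) :
  discrete_singularities setT Omega0 -> open D -> conj_invariant D ->
  ~` Omega0 = circularization D -> locally_finite (~` D).
Proof.
move=> [_ _ iso] Do Dc OD; apply: locally_finite_isolated => a.
have [J SJ] := SA_nonempty R k.
have OE z : Omega0 (spt z J) <-> ~ D z.
  have := circularizationP z Dc SJ; rewrite -OD => H.
  split => [Oz /H|nD]; first exact.
  by apply: contrapT => /H.
have [Da|Da] := pselect (D a).
  by move: ((open_evt D).1 Do a Da); apply: evtS => z Dz /(_ Dz).
have [U Uo US] := iso _ ((OE a).2 Da).
have Ua : U (spt a J).
  suff : (Omega0 `&` U) (spt a J) by case.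
  by rewrite US; exists a, J, J.
have : nbhs a ((fun z : C => spt z J) @^-1` U).
  apply: spt_continuous; exact: open_nbhs_nbhs.
move=> /evtE; apply: evtS => z /= Uz /OE Oz.
have : (Omega0 `&` U) (spt z J) by [].
rewrite US => -[w [I [I' [SI SI' /(spt_inj SJ SI) aw /(spt_inj SJ SI') zw]]]].
have {aw} aw : w = a \/ w = conjc a by case: aw => [[->]|[]]; [left|right].
have {zw} zw : w = z \/ w = conjc z by case: zw => [[->]|[]]; [left|right].
case: zw => [<- //|zw].
by rewrite -[z]conjcK -zw; case: aw => ->; [right|left; rewrite conjcK].
Qed.

Lemma profile_setT : profile (setT : set A) = setT.
Proof.
apply/seteqP; split => // z _; have [J SJ] := SA_nonempty R k; by exists J.
Qed.

End Singularities.

(** * The global quotient representation *)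

Theorem theorem6p10 (R : realType) (k : HO) (Omega0 : set (HOalg R k))
    (f : HOalg R k -> HOalg R k) :
  discrete_singularities setT Omega0 ->
  slice_nash (HOu k) (~` Omega0) f ->
  exists P Q : seq (HOalg R k),
    let dom := slice_inv_dom setT (slice_poly Q) in
    [/\ dom !=set0,
        ~` Omega0 `<=` dom &
        forall x, (~` Omega0) x ->
          f x = slice_mul dom (slice_inv setT (slice_poly Q)) (slice_poly P) x].
Proof.
move=> sing [D [F [[Do OD FS Ff] [_ [I0 [e [G1 [G2 [_ _ _ FE Gn]]]]]]]]].
have [Dc Fc] := FS.
have Dlf := singularities_locally_finite sing Do Dc OD.
pose G (t : 'I_(HOu k).+1 * bool) := if t.2 then G1 t.1 else G2 t.1.
have Gnash t : complex_nash D (G t) by case: t => j []; case: (Gn j).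
have [r [p [rc rG]]] := common_denominator Do Dc Dlf Gnash.
(* Regrouping the C_I-expansion along the real splitting base [e j], [I0 e j] turns the coefficients
   into complex functions acting through iota, so that polynomials in z can replace them. *)
have FE' z : D z -> F z = \sum_(j < (HOu k).+1)
    (cact (G (j, true) z) (e j, 0) + cact (G (j, false) z) (smul I0 (e j), 0)).
  move=> Dz; have [F1 F2] := FE z Dz.
  rewrite [LHS]surjective_pairing [RHS]surjective_pairing fst_sum snd_sum F1 F2.
  by congr (_, _); apply: eq_bigr => j _;
    rewrite /Defs.cscale spt_smul /= !scaler0 ?subr0 ?add0r.
have [P PE] : exists a : seq (HOalg R k),
    forall z, D z -> poly_stem a z = cact r.[z] (F z).
  apply: (@poly_map_stem R k D (fun z => \sum_(j < (HOu k).+1)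
    (cact (p (j, true)).[z] (e j, 0) +
     cact (p (j, false)).[z] (smul I0 (e j), 0)))).
  - by apply: poly_map_sum => j; apply: poly_mapD; exact: poly_map_cact.
  - by apply: cact_stem => // z _; exact: rc.
  move=> z Dz; rewrite FE' // cact_sum; apply: eq_bigr => j _.
  by have [_ H] := rG z Dz; rewrite cactD -!cactM !H.
(* Since [r] has real coefficients, it defines a slice polynomial whose stem function is the scalar
   r(z). *)
pose Q : seq (HOalg R k) := mkseq (fun i => complex.Re r`_i *: sone) (size r).
have QE z : poly_stem Q z = cscalar k r.[z].
  rewrite /poly_stem size_mkseq horner_coef.
  rewrite (_ : cscalar k _ = cact (\sum_(i < size r) r`_i * z ^+ i) (sone, 0)); last first.
    by rewrite /cscalar /cact /= !scaler0 subr0 add0r.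
  rewrite cact_suml; apply: eq_bigr => s _.
  rewrite nth_mkseq // [X in cact (X * _)](real_coefs rc) mulrC cactM.
  by congr (cact _ _); rewrite /cact /= !scaler0 !scale0r subr0 addr0.
have Tc : conj_invariant (setT : set (R[i]^o)) by [].
have QS := poly_stem_stem (k := k) Q Tc.
have stQ z : stem_of setT (slice_poly Q) z = cscalar k r.[z].
  rewrite -QE; apply: stem_of_eq; rewrite ?profile_setT //.
  exact: poly_stem_induces.
have conjE : slice_conj setT (slice_poly Q) = slice_of (fun z => cscalar k r.[z]).
  rewrite /slice_conj; congr slice_of; apply/funext => z.
  rewrite stQ /acconj /cscalar /=.
  by rewrite !(sconjZ (HOalg_star_bilinear R k)) !(sconj1 (HOalg_star_bilinear R k)).
have rS (D' : set (R[i]^o)) : conj_invariant D' ->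
  stem D' (fun z => cscalar k r.[z]).
  by move=> D'c; apply: cscalar_stem => // z _; exact: rc.
have conjV z J : SA J -> slice_conj setT (slice_poly Q) (spt z J) = spt r.[z] J.
  by move=> SJ; rewrite conjE (slice_of_spt (rS _ Tc)) // spt_cscalar.
have stQc z : stem_of setT (slice_conj setT (slice_poly Q)) z = cscalar k r.[z].
  apply: (@stem_of_eq R k setT _ (fun z => cscalar k r.[z])); rewrite profile_setT //.
    exact: rS.
  by move=> w J _ SJ; rewrite conjV // spt_cscalar.
have normV z J : SA J -> slice_norm setT (slice_poly Q) (spt z J) =
    spt (r.[z] * r.[z]) J.
  move=> SJ; rewrite /slice_norm /slice_mul.
  rewrite (_ : (fun z => _) = (fun z => cscalar k (r.[z] * r.[z]))); last first.
    apply/funext => w; rewrite stQ stQc acmul_cscalar.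
    by rewrite /cact /cscalar cReM cImM /= !scalerA -scalerBl -scalerDl [_ * complex.Re _ + _]addrC addrC mulrC.
  rewrite (@slice_of_spt R k setT) ?spt_cscalar //.
  by apply: cscalar_stem => // w _; rewrite rc rmorphM.
pose dom := slice_inv_dom setT (slice_poly Q).
have spt0 z (J : HOalg R k) : SA J -> (spt z J == 0) = (z == 0).
  move=> SJ; have sp0 : spt 0 J = 0 by rewrite /spt /= !scale0r addr0.
  apply/eqP/eqP => [|->]; last exact: sp0.
  rewrite -[X in _ = X]sp0 => /(spt_inj SJ SJ)[[]|[+ _]] //.
  by move=> /esym /eqP; rewrite conjc_eq0 => /eqP.
have domE z J : SA J -> dom (spt z J) <-> r.[z] != 0.
  move=> SJ; rewrite /dom /slice_inv_dom /= normV // spt0 // mulf_eq0 orbb.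
  by split => [[]|].
have prof z : profile dom z <-> r.[z] != 0.
  have [J SJ] := SA_nonempty R k.
  by split => [[J' SJ' /(domE _ _ SJ')]//|rz]; exists J => //; exact/domE.
have profc : conj_invariant (profile dom).
  by move=> z /prof rz; apply/prof; rewrite rc conjc_eq0.
have rVc z : profile dom z -> (r.[conjc z])^-1 = conjc (r.[z])^-1.
  by move=> _; rewrite rc fmorphV.
(* On each slice N(Q) = r^2 and Q^c = r, so the slice inverse is r / r^2. *)
have invV z J : SA J -> r.[z] != 0 ->
    slice_inv setT (slice_poly Q) (spt z J) = spt (r.[z])^-1 J.
  move=> SJ rz; rewrite /slice_inv normV // conjV // sinv_spt ?mulf_neq0 //.
  by rewrite spt_spt // invfM divfK.
have stinv z : profile dom z -> stem_of dom (slice_inv setT (slice_poly Q)) z =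
    cscalar k (r.[z])^-1.
  apply: (@stem_of_eq R k dom _ (fun z => cscalar k (r.[z])^-1)).
    exact: cscalar_stem.
  by move=> w J /prof rw SJ; rewrite invV // spt_cscalar.
have stP z : profile dom z -> stem_of dom (slice_poly P) z = poly_stem P z.
  by apply: stem_of_eq; [exact: poly_stem_stem|exact: poly_stem_induces].
have Dprof : D `<=` profile dom by move=> z /rG[rz _]; apply/prof.
have subdom : ~` Omega0 `<=` dom.
  by rewrite OD => x [z [J [Dz SJ ->]]]; apply/domE => //; case: (rG z Dz).
have mulE z : profile dom z ->
    acmul (stem_of dom (slice_inv setT (slice_poly Q)) z)
          (stem_of dom (slice_poly P) z) = cact (r.[z])^-1 (poly_stem P z).
  by move=> dz; rewrite stinv // stP // acmul_cscalar.
have mulS : stem (profile dom) (fun z =>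
    acmul (stem_of dom (slice_inv setT (slice_poly Q)) z)
          (stem_of dom (slice_poly P) z)).
  have [_ H] := cact_stem rVc (poly_stem_stem P profc).
  by split => // z dz; rewrite !mulE ?H //; exact: profc.
exists P, Q; split => //.
  have [a /contrapT Da _] : exists2 a, ~ (~` D) a & setT a.
    by apply: (locally_finite_other (a := 0) Dlf); exact: evtW.
  have [J SJ] := SA_nonempty R k.
  by exists (spt a J); apply/domE => //; case: (rG a Da).
rewrite OD => x [z [J [Dz SJ ->]]].
(* The stem function of the product is (1/r) times that of P, and on [D] the latter is r F. *)
rewrite (Ff z J Dz SJ) /slice_mul (slice_of_spt mulS) //; last exact: Dprof.
rewrite mulE; last exact: Dprof.
rewrite PE // -cactM mulVf ?cact1 //; by case: (rG z Dz).
Qed.
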